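(* Let $\alpha>-1/2$ and let $\sigma > 0$. The following bounds hold uniformly in $x,y \in \mathbb{R}$. (A) Assume that $xy \ge 0$. (Ai) If $|x|+|y| \le 1$, then $$\mathbb{H}^{\alpha,\sigma}(x,y) \simeq \chi_{\{\sigma>\alpha+1\}} + \chi_{\{\sigma=\alpha+1\}} \log\frac{1}{|x|+|y|} + (|x|+|y|)^{-2\alpha-1} \begin{cases} |x-y|^{2\sigma-1}, & \sigma< 1/2,\\ \log \frac{2(|x|+|y|)}{|x-y|}, & \sigma=1/2,\\ (|x|+|y|)^{2\sigma-1}, & \sigma>1/2. \end{cases}$$ (Aii) If $|x|+|y| > 1$, then $$\mathbb{H}^{\alpha,\sigma}(x,y) \simeq \simeq (|x|+|y|)^{-2\alpha-1} \exp\big(-c|x-y|\big) \begin{cases} |x-y|^{2\sigma-1}, & \sigma< 1/2,\\ 1+\log^+ \frac{1}{|x-y|}, & \sigma=1/2,\\ 1, & \sigma>1/2. \end{cases}$$ (B) Assume that $xy< 0$. (Bi) If $|x|+|y| \le 1$, then $$\mathbb{H}^{\alpha,\sigma}(x,y) \simeq \chi_{\{\sigma>\alpha+1\}} + \chi_{\{\sigma=\alpha+1\}} \log\frac{1}{|x|+|y|} + (|x|+|y|)^{2\sigma-2\alpha-2}.$$ (Bii) If $|x|+|y| > 1$, then $$\mathbb{H}^{\alpha,\sigma}(x,y) \simeq \simeq (|x|+|y|)^{-2\alpha-1} \exp\big(-c|x+y|\big)(|x|+|y|)^{-2}.$$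
   Context: For $\alpha>-1$ let $I_\alpha$ denote the modified Bessel function of the first kind of order $\alpha$, and for $t,x,y>0$ let $$W_t^{\alpha}(x,y)=\frac{1}{2t}\exp\Big(-\frac{x^2+y^2}{4t}\Big)(xy)^{-\alpha}I_\alpha\Big(\frac{xy}{2t}\Big),$$ extended to $x=0$ or $y=0$ by taking limits. Define $$\mathbb W_t^{\alpha}(x,y)=\frac12\Big[W_t^{\alpha}(|x|,|y|)+xy\,W_t^{\alpha+1}(|x|,|y|)\Big],\qquad x,y\in\mathbb R,\ t>0,$$ and the Bessel potential kernel $$\mathbb H^{\alpha,\sigma}(x,y)=\frac1{\Gamma(\sigma)}\int_0^\infty e^{-t}\,\mathbb W_t^{\alpha}(x,y)\,t^{\sigma-1}\,dt,\qquad x,y\in\mathbb R.$$ $\chi_{\{\cdot\}}$ equals $1$ if the condition holds and $0$ otherwise; $\log^+=\max(\log,0)$. $X\simeq Y$ means $C^{-1}Y\le X\le CY$ with $C>0$ independent of $x,y$. $X\simeq\simeq Y\exp(-cZ)$ (with $Y$ the product of all the non-exponential factors) means that there are constants $C,c_1,c_2>0$ independent of $x,y$ such that $C^{-1}Y\exp(-c_1Z)\le X\le C\,Y\exp(-c_2Z)$. Positive expressions are valued in $[0,\infty]$, with natural limiting interpretations (e.g. $0^\beta=\infty$ for $\beta<0$). *)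

(* Defs.v *)
From HB Require Import structures.
From mathcomp Require Import all_boot all_order all_algebra.
From mathcomp Require Import all_classical all_reals all_analysis.

Set Implicit Arguments.
Unset Strict Implicit.
Unset Printing Implicit Defensive.

Import Order.TTheory GRing.Theory Num.Theory.
Import numFieldNormedType.Exports.

Local Open Scope classical_set_scope.
Local Open Scope ring_scope.

(* Euler's integral; used only for s > 0. *)
Definition Gamma (R : realType) (s : R) : R :=
  \int[@lebesgue_measure R]_(t in `]0, +oo[) (expR (- t) * t `^ (s - 1)).

(* The power series of I_alpha(z); used only for alpha > -1 and z > 0, so that
   all the values of Gamma below are at positive arguments. *)
Definition besselI (R : realType) (alpha z : R) : R :=
  limn (series (fun k : nat =>
    (z / 2) `^ (k.*2%:R + alpha) / (k`!%:R * Gamma (k%:R + alpha + 1)))).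

Definition heat_kernel_pos (R : realType) (alpha t x y : R) : R :=
  (2 * t)^-1 * expR (- ((x ^+ 2 + y ^+ 2) / (4 * t))) *
  (x * y) `^ (- alpha) * besselI alpha (x * y / (2 * t)).

(* For x, y >= 0 with x = 0 or y = 0, the value is the limit of the formula at
   (x, y) along pairs of positive reals. *)
Definition heat_kernel (R : realType) (alpha t x y : R) : R :=
  if (0 < x) && (0 < y) then heat_kernel_pos alpha t x y
  else lim (heat_kernel_pos alpha t p.1 p.2 @[p -->
    within [set q : R * R | 0 < q.1 /\ 0 < q.2] (nbhs (x, y))]).

Definition dunkl_heat_kernel (R : realType) (alpha t x y : R) : R :=
  2^-1 * (heat_kernel alpha t `|x| `|y| +
          x * y * heat_kernel (alpha + 1) t `|x| `|y|).

Definition bessel_potential_kernel (R : realType) (alpha sigma x y : R) :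
    \bar R :=
  ((Gamma sigma)^-1%:E * \int[@lebesgue_measure R]_(t in `]0%R, +oo[)
     (expR (- t) * dunkl_heat_kernel alpha t x y * t `^ (sigma - 1))%R%:E)%E.

(* a ^ b in [0, +oo] for a >= 0; the library's powR has 0 `^ b = 0 for b < 0. *)
Definition epow (R : realType) (a b : R) : \bar R :=
  if (a == 0) && (b < 0) then +oo%E else (a `^ b)%:E.

(* a / b in [0, +oo] for a, b >= 0. The value of 0 / 0 is +oo, whereas
   (a%:E / b%:E)%E would be 0 there. *)
Definition equot (R : realType) (a b : R) : \bar R :=
  if b == 0 then +oo%E else (a / b)%:E.

(* 1 if the condition holds and 0 otherwise; 0 * +oo = 0 in \bar R. *)
Definition chi (R : realType) (b : bool) : \bar R := (b%:R : R)%:E.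

(* X ~ Y on the set of pairs (x, y) described by P. *)
Definition comparable_on (R : realType) (P : R -> R -> Prop)
    (X Y : R -> R -> \bar R) : Prop :=
  exists2 C : R, 0 < C & forall x y : R, P x y ->
    (C^-1%:E * Y x y <= X x y <= C%:E * Y x y)%E.

(* X ~~ Y exp(- c Z) on P: the constants in the exponents of the lower and the
   upper bound may differ. *)
Definition exp_comparable_on (R : realType) (P : R -> R -> Prop)
    (X Y : R -> R -> \bar R) (Z : R -> R -> R) : Prop :=
  exists C c1 c2 : R, [/\ 0 < C, 0 < c1, 0 < c2 & forall x y : R, P x y ->
    (C^-1%:E * (Y x y * (expR (- (c1 * Z x y)))%R%:E) <= X x y <=
     C%:E * (Y x y * (expR (- (c2 * Z x y)))%R%:E))%E].

(* Main.v *)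
Require Import Defs.
From HB Require Import structures.
From mathcomp Require Import all_boot all_order all_algebra.
From mathcomp Require Import all_classical all_reals all_analysis.
From mathcomp Require Import measurable_realfun ring lra.
Import Order.TTheory GRing.Theory Num.Theory.
Import numFieldNormedType.Exports.
Local Open Scope ring_scope.

(** The proof has three layers.

    Bessel functions. Put u = z^(-alpha) I_alpha(z) and
    v = z^(-alpha) I_(alpha+1)(z), both entire functions of z. Since
    |xy| = 2tz for z = |xy|/2t, the kernel is an elementary Gaussian factor
    times q = u + v when xy >= 0 and times p = u - v when xy < 0. The power
    series give u' = v and v' = u - 2 kappa v/z with kappa = alpha + 1/2 > 0,
    hence, for P = z^kappa e^z p and Q = z^kappa e^(-z) q,

      P' = kappa z^(-1) e^(2z) Q   and   Q' = kappa z^(-1) e^(-2z) P.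

    So P increases and p stays positive although it is a difference. For
    z >= 1, comparing derivatives bounds P by a multiple of z^(-1) e^(2z) Q,
    after which Q'/Q is at most a multiple of z^(-2), so Q stays bounded;
    P is then of the exact order z^(-1) e^(2z). This yields
    q ~ (1+z)^(-kappa) e^z and p ~ (1+z)^(-kappa-1) e^z on z >= 0
    ([bessel_plus_bounds], [bessel_minus_bounds]), without any asymptotic
    expansion.

    Reduction to one integral. Let s = |x| + |y| and d = ||x| - |y||, which is
    |x - y| or |x + y| according to the sign of xy. The exponential growth of
    p and q completes the square in the Gaussian, and t + |xy| may be replaced
    by t + s^2 at the price of a smaller constant in the Gaussian
    ([growth_kernel_bounds]). The potential kernel is thus squeezed between
    two multiples, with different c > 0, of

      int_0^oo e^(-t) t^(tau-1) (t + s^2)^(-A) e^(-c d^2/t) dt,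

    where A = alpha + 1/2, tau = sigma - 1/2 if xy >= 0 and
    A = alpha + 3/2, tau = sigma + 1/2 if xy < 0.

    The integral. The integrand is a pure power of t on each of the ranges
    d^2 < t < s^2 and s^2 < t < 1, and it is cut off exponentially outside.
    The integral of a power over an interval has the size of its dominant
    end, or is a logarithm ([powsize]); this gives the three regimes for
    sigma against 1/2, from the first range, and against alpha + 1, from
    the second. If s > 1, the factor (t + s^2)^(-A) is s^(-2A) up to powers
    of 1 + t, and e^(-t - c d^2/t) accounts for the decay in d by the
    inequality of arithmetic and geometric means. The integral decreases in
    s and in d, so its divergence on the diagonal and at the origin follows
    by letting d and s tend to 0 in the lower bounds. *)

(** * Integration over subintervals of the positive half-line *)

Section Integration.
Context {R : realType}.
Local Open Scope classical_set_scope.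
Notation mu := (@lebesgue_measure R).
Implicit Types (f g F : R -> R) (a b : R).

Lemma integral_is_derive f F a b : a <= b ->
  (forall x, a <= x <= b -> is_derive x (1 : R) F (f x)) ->
  (forall x, a <= x <= b -> {for x, continuous f}) ->
  (\int[mu]_(x in `[a, b]) (f x)%:E = (F b - F a)%:E)%E.
Proof.
rewrite le_eqVlt => /predU1P[<-|ab] dF cf.
  by rewrite set_itv1 integral_set1 subrr.
have cF x : a <= x <= b -> {for x, continuous F}.
  move=> /dF[dFx _]; apply/differentiable_continuous.
  exact/derivable1_diffP.
rewrite (@continuous_FTC2 _ f F)//.
- by apply: continuous_in_subspaceT => x; rewrite inE/= in_itv/=; exact: cf.
- split.
  + by move=> x; rewrite in_itv/= => /andP[ax xb]; have [] := dF x; rewrite ?ltW.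
  + by apply: cvg_at_right_filter; apply: cF; rewrite lexx ltW.
  + by apply: cvg_at_left_filter; apply: cF; rewrite lexx ltW.
- move=> x; rewrite in_itv/= => /andP[ax xb]; rewrite derive1E.
  by have [] := dF x; rewrite ?ltW.
Qed.

(** Monotone convergence, in the form in which improper integrals are estimated
    here. *)
Lemma integral_bigcup_le (F : (set R)^nat) (f : R -> R) (M : \bar R) :
  nondecreasing_seq F -> (forall i, measurable (F i)) ->
  (forall i, measurable_fun (F i) f) ->
  (forall i x, F i x -> 0 <= f x) ->
  (forall i, \int[mu]_(x in F i) (f x)%:E <= M)%E ->
  (\int[mu]_(x in \bigcup_i F i) (f x)%:E <= M)%E.
Proof.
move=> ndF mF mf f0 FM.
have cvgF : (\int[mu]_(x in F i) (f x)%:E @[i --> \oo] -->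
    \int[mu]_(x in \bigcup_i F i) (f x)%:E)%E.
  apply: ge0_nondecreasing_set_cvg_integral => //.
  by move=> i; apply/measurable_EFinP; exact: mf.
rewrite -(cvg_lim _ cvgF)//; apply: lime_le; last exact: nearW.
apply: ereal_nondecreasing_is_cvgn.
apply: ge0_nondecreasing_set_nondecreasing_integral => //.
by move=> i; apply/measurable_EFinP; exact: mf.
Qed.

Lemma itv_ocE a b : 0 <= a ->
  `]a, b] = \bigcup_n `[a + n.+1%:R^-1, b] :> set R.
Proof.
move=> a0; apply/seteqP; split => x /=; rewrite in_itv/=.
  move=> /andP[ax xb]; have xa : 0 < (x - a) by rewrite subr_gt0.
  have [n nx] : exists n : nat, (x - a)^-1 < n.+1%:R.
    by exists (Num.truncn (x - a)^-1); rewrite truncnS_gt.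
  exists n => //=; rewrite in_itv/= xb andbT -lerBrDl.
  by rewrite invf_ple ?posrE// ltW.
move=> [n _]; rewrite /= in_itv/= => /andP[anx ->]; rewrite andbT.
by rewrite (lt_le_trans _ anx)// ltrDl invr_gt0.
Qed.

Lemma itv_cyE a : `[a, +oo[ = \bigcup_n `[a, a + n%:R] :> set R.
Proof.
apply/seteqP; split => x /=; rewrite in_itv/= ?andbT.
  move=> ax; exists (Num.truncn (x - a)).+1 => //=.
  by rewrite in_itv/= ax/= -lerBlDl ltW// truncnS_gt.
by move=> [n _]; rewrite /= in_itv/= => /andP[].
Qed.

Definition posmeasurable f := measurable_fun (`]0%R, +oo[ : set R) f.

Lemma posmeasurableS f (D : set R) : measurable D ->
  D `<=` (`]0, +oo[ : set R) -> posmeasurable f -> measurable_fun D f.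
Proof. by move=> mD D0; apply: measurable_funS. Qed.

Lemma sub_pos_itv (i : interval R) : (BRight 0 <= i.1)%O ->
  [set` i] `<=` (`]0, +oo[ : set R).
Proof.
case: i => l r /= l0; apply: (@subset_trans _ [set` Interval (BRight 0) r]).
  exact: subset_itvr.
by apply: subset_itvl; case: r => // -[].
Qed.

Lemma integral_oc_le f b M : 0 < b -> posmeasurable f ->
  (forall x, 0 < x -> 0 <= f x) ->
  (forall a, 0 < a <= b -> (\int[mu]_(x in `[a, b]) (f x)%:E <= M)%E) ->
  (\int[mu]_(x in `]0%R, b]) (f x)%:E <= M)%E.
Proof.
move=> b0 mf f0 fM; rewrite itv_ocE//.
have pos n : `[0 + n.+1%:R^-1, b] `<=` (`]0, +oo[ : set R).
  by apply: sub_pos_itv; rewrite /= bnd_simp add0r invr_gt0.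
apply: integral_bigcup_le.
- move=> m n mn; rewrite subsetEset; apply: subset_itvr.
  by rewrite bnd_simp lerD2l lef_pV2 ?posrE// ler_nat.
- by move=> i; exact: measurable_itv.
- by move=> i; exact: posmeasurableS mf.
- by move=> i x /pos; rewrite /= in_itv/= andbT; exact: f0.
- move=> i; rewrite add0r; have [ib|bi] := leP i.+1%:R^-1 b.
    by apply: fM; rewrite invr_gt0 ltr0n.
  rewrite set_itv_ge ?integral_set0 -?ltNge ?bnd_simp//.
  have : (\int[mu]_(x in `[b, b]) (f x)%:E <= M)%E by apply: fM; rewrite b0 lexx.
  by rewrite set_itv1 integral_set1.
Qed.

Lemma integral_cy_le f a M : 0 < a -> posmeasurable f ->
  (forall x, 0 < x -> 0 <= f x) ->
  (forall b, a <= b -> (\int[mu]_(x in `[a, b]) (f x)%:E <= M)%E) ->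
  (\int[mu]_(x in `[a, +oo[) (f x)%:E <= M)%E.
Proof.
move=> a0 mf f0 fM; rewrite itv_cyE//.
have pos n : `[a, a + n%:R] `<=` (`]0, +oo[ : set R).
  by apply: sub_pos_itv; rewrite /= bnd_simp.
apply: integral_bigcup_le.
- move=> m n mn; rewrite subsetEset; apply: subset_itvl.
  by rewrite bnd_simp lerD2l ler_nat.
- by move=> i; exact: measurable_itv.
- by move=> i; exact: posmeasurableS mf.
- by move=> i x /pos; rewrite /= in_itv/= andbT; exact: f0.
- by move=> i; apply: fM; rewrite lerDl.
Qed.

Lemma le_integral_pos f g (D : set R) : measurable D -> D `<=` (`]0, +oo[ : set R) ->
  posmeasurable f -> posmeasurable g ->
  (forall x, D x -> 0 <= f x <= g x) ->
  (\int[mu]_(x in D) (f x)%:E <= \int[mu]_(x in D) (g x)%:E)%E.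
Proof.
move=> mD D0 mf mg fg; apply: ge0_le_integral => //.
- by move=> x /fg/andP[].
- by apply/measurable_EFinP; exact: posmeasurableS mf.
- by apply/measurable_EFinP; exact: posmeasurableS mg.
- by move=> x /fg/andP[].
Qed.

Lemma le_integral_sub f (D E : set R) : measurable D -> measurable E ->
  D `<=` E -> E `<=` (`]0, +oo[ : set R) ->
  posmeasurable f -> (forall x, 0 < x -> 0 <= f x) ->
  (\int[mu]_(x in D) (f x)%:E <= \int[mu]_(x in E) (f x)%:E)%E.
Proof.
move=> mD mE DE E0 mf f0; apply: ge0_subset_integral => //.
- by apply/measurable_EFinP; exact: posmeasurableS mf.
- by move=> x /E0; rewrite /= in_itv/= andbT lee_fin; exact: f0.
Qed.

Lemma integral_posZ (k : R) f (D : set R) : measurable D -> D `<=` (`]0, +oo[ : set R) ->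
  posmeasurable f -> (forall x, 0 < x -> 0 <= f x) -> 0 <= k ->
  (\int[mu]_(x in D) (k * f x)%:E = k%:E * \int[mu]_(x in D) (f x)%:E)%E.
Proof.
move=> mD D0 mf f0 k0.
under eq_integral do rewrite EFinM.
rewrite ge0_integralZl//.
- by apply/measurable_EFinP; exact: posmeasurableS mf.
- by move=> x /D0; rewrite /= in_itv/= andbT lee_fin; exact: f0.
Qed.

Lemma integral_pos_split f a : 0 < a ->
  posmeasurable f -> (forall x, 0 < x -> 0 <= f x) ->
  (\int[mu]_(x in `]0%R, +oo[) (f x)%:E = \int[mu]_(x in `]0%R, a]) (f x)%:E +
     \int[mu]_(x in `[a, +oo[) (f x)%:E)%E.
Proof.
move=> a0 mf f0.
rewrite -[X in (_ + X)%E]integral_itv_obnd_cbnd; last first.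
  apply/measurable_EFinP; apply: posmeasurableS mf => //.
  by apply: sub_pos_itv; rewrite /= bnd_simp ltW.
rewrite -ge0_integral_setU//.
- congr (integral _ _ _); apply/seteqP; split => x /=; rewrite !in_itv/= ?andbT.
    by move=> ->; case: (leP x a) => /= xa; [left|right].
  by move=> [/andP[]//|]; apply: lt_trans.
- apply/measurable_EFinP; apply: posmeasurableS mf => //.
    exact: measurableU.
  move=> x /= []; rewrite !in_itv/= ?andbT; last exact: lt_trans.
  by move=> /andP[].
- move=> x /= [|]; rewrite !in_itv/= ?andbT lee_fin.
    by move=> /andP[+ _]; exact: f0.
  by move=> /(lt_trans a0); exact: f0.
- rewrite disj_set2E; apply/eqP/seteqP; split => x //=.
  by rewrite !in_itv/= andbT => -[/andP[_ xa]]; rewrite ltNge xa.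
Qed.

Lemma integral_oc_split f a b : 0 < a <= b ->
  posmeasurable f -> (forall x, 0 < x -> 0 <= f x) ->
  (\int[mu]_(x in `]0%R, b]) (f x)%:E = \int[mu]_(x in `]0%R, a]) (f x)%:E +
     \int[mu]_(x in `[a, b]) (f x)%:E)%E.
Proof.
move=> /andP[a0 ab] mf f0.
rewrite -[X in (_ + X)%E]integral_itv_obnd_cbnd; last first.
  apply/measurable_EFinP; apply: posmeasurableS mf => //.
  by apply: sub_pos_itv; rewrite /= bnd_simp ltW.
rewrite -ge0_integral_setU//.
- congr (integral _ _ _); apply/seteqP; split => x /=; rewrite !in_itv/= ?andbT.
    by move=> /andP[-> ->]; rewrite andbT; case: (leP x a) => /= xa; [left|right].
  by move=> [/andP[-> xa]|/andP[ax ->]]; rewrite ?(le_trans xa)// (lt_trans a0).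
- apply/measurable_EFinP; apply: posmeasurableS mf => //.
    exact: measurableU.
  move=> x /= [|]; rewrite !in_itv/= ?andbT => /andP[]//.
  by move=> /(lt_trans a0).
- move=> x /= [|]; rewrite !in_itv/= ?andbT lee_fin.
    by move=> /andP[+ _]; exact: f0.
  by move=> /andP[/(lt_trans a0) + _]; exact: f0.
- rewrite disj_set2E; apply/eqP/seteqP; split => x //=.
  by rewrite !in_itv/= => -[/andP[_ xa]]; rewrite ltNge xa.
Qed.

End Integration.

(** * Derivatives, exponentials and powers *)

Section Calculus.
Context {R : realType}.
Local Open Scope classical_set_scope.
Implicit Types (f g : R -> R) (x : R).

Lemma is_derive_mul f g x df dg : is_derive x (1 : R) f df ->
  is_derive x (1 : R) g dg ->
  is_derive x (1 : R) (fun t => f t * g t) (df * g x + f x * dg).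
Proof.
move=> hf hg; apply: (@is_derive_eq _ _ _ (f * g)).
by rewrite addrC /GRing.scale/= [g x * _]mulrC.
Qed.

Lemma is_derive_comp f g x df dg : is_derive (g x) (1 : R) f df ->
  is_derive x (1 : R) g dg ->
  is_derive x (1 : R) (fun t => f (g t)) (df * dg).
Proof. by move=> hf hg; exact: (@is_derive1_comp _ f g). Qed.

Lemma is_derive_scale (k : R) f x df : is_derive x (1 : R) f df ->
  is_derive x (1 : R) (fun t => k * f t) (k * df).
Proof. by move=> hf; apply: (@is_derive_eq _ _ _ (k \*: f)). Qed.

Lemma is_derive_lin (k x : R) : is_derive x (1 : R) (fun t => k * t) k.
Proof.
by apply: (is_derive_eq (is_derive_scale k id x 1 (is_derive_id x 1))); rewrite mulr1.
Qed.

Lemma is_derive_add f g x df dg : is_derive x (1 : R) f df ->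
  is_derive x (1 : R) g dg ->
  is_derive x (1 : R) (fun t => f t + g t) (df + dg).
Proof. by move=> hf hg; apply: (@is_derive_eq _ _ _ (f + g)). Qed.

Lemma is_derive_sub f g x df dg : is_derive x (1 : R) f df ->
  is_derive x (1 : R) g dg ->
  is_derive x (1 : R) (fun t => f t - g t) (df - dg).
Proof. by move=> hf hg; apply: (@is_derive_eq _ _ _ (f - g)). Qed.

Lemma is_derive_expRM (k x : R) :
  is_derive x (1 : R) (fun t => expR (k * t)) (k * expR (k * x)).
Proof.
rewrite [k * expR _]mulrC; apply: (@is_derive_comp expR (fun t => k * t)).
exact: is_derive_lin.
Qed.

Lemma is_derive_continuous f x df : is_derive x (1 : R) f df ->
  {for x, continuous f}.
Proof.
move=> [dfx _]; apply/differentiable_continuous; exact/derivable1_diffP.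
Qed.

Lemma continuous_powR (p x : R) : 0 < x -> {for x, continuous (fun t => t `^ p)}.
Proof. by move=> x0; apply: is_derive_continuous; exact: is_derive1_powR. Qed.

Lemma nondecreasing_is_derive (a : R) f df :
  (forall x, a <= x -> is_derive x (1 : R) f (df x)) ->
  (forall x, a <= x -> 0 <= df x) ->
  forall x y, a <= x -> x <= y -> f x <= f y.
Proof.
move=> hf df0; apply: ger0_derive1_ndecry.
- by move=> x; rewrite in_itv/= andbT => /ltW/hf[].
- move=> x; rewrite in_itv/= andbT => /ltW ax.
  by rewrite derive1E; have [_ ->] := hf _ ax; exact: df0.
- apply: continuous_in_subspaceT => x; rewrite inE/= in_itv/= andbT => ax.
  exact: is_derive_continuous (hf _ ax).
Qed.

(** Rounding the exponent up to an integer, one term of the exponential series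
    suffices. *)
Lemma powR_le_expR (a c : R) : 0 <= a -> 0 < c ->
  exists2 C : R, 0 < C & forall x, 0 <= x -> x `^ a <= C * expR (c * x).
Proof.
move=> a0 c0.
pose n := (Num.truncn a).+1.
have an : a <= n%:R by rewrite ltW// truncnS_gt.
exists (1 + n`!%:R * c^-1 ^+ n).
  by rewrite ltr_wpDr// mulr_ge0// exprn_ge0// invr_ge0 ltW.
move=> x x0.
have e1 : 1 <= expR (c * x) by rewrite -expR0 ler_expR mulr_ge0// ltW.
rewrite mulrDl mul1r.
have [x1|x1] := leP x 1.
  rewrite ler_wpDr//.
    by rewrite !mulr_ge0 ?expR_ge0// exprn_ge0// invr_ge0 ltW.
  apply: le_trans e1; move: x0; rewrite le_eqVlt => /predU1P[<-|x0].
    by have [->|an0] := eqVneq a 0; rewrite ?powRr0// powR0.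
  rewrite -[leRHS](powRr0 x); apply: ger_powR => //.
  by rewrite x0.
rewrite ler_wpDl ?expR_ge0//.
apply: (@le_trans _ _ (x ^+ n)).
  by rewrite -powR_mulrn//; apply: ler_powR => //; exact: ltW.
have := @expR_ge1Dxn R (c * x) (Num.truncn a) (mulr_ge0 (ltW c0) x0).
rewrite -/n => /(le_trans _); rewrite -ler_pdivrMl; last first.
  by rewrite mulr_gt0// ?ltr0n ?fact_gt0// exprn_gt0// invr_gt0.
apply; rewrite ler_wpDl// invfM exprMn exprVn invrK.
by rewrite mulrC mulrA mulrAC [x ^+ n * _]mulrC.
Qed.

End Calculus.

(** * Integrals of powers *)

Section PowerIntegrals.
Context {R : realType}.
Local Open Scope classical_set_scope.
Notation mu := (@lebesgue_measure R).
Implicit Types (p a b c : R) (f g : R -> R).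

Lemma posmeasurable_powR p : posmeasurable (fun t : R => t `^ p).
Proof. by apply: measurable_funTS; exact: measurable_powR. Qed.

Lemma posmeasurableM f g : posmeasurable f -> posmeasurable g ->
  posmeasurable (fun t => f t * g t).
Proof. exact: measurable_funM. Qed.

Lemma posmeasurable_cst c : posmeasurable (fun=> c).
Proof. exact: measurable_cst. Qed.

Lemma continuous_posmeasurable f : (forall x, 0 < x -> {for x, continuous f}) ->
  posmeasurable f.
Proof.
move=> cf; apply: open_continuous_measurable_fun => //.
by move=> x; rewrite inE/= in_itv/= andbT; exact: cf.
Qed.

Lemma posmeasurable_exp f : posmeasurable f -> posmeasurable (fun t => expR (f t)).
Proof. by move=> mf; apply: measurableT_comp. Qed.

Lemma posmeasurable_expN c : posmeasurable (fun t => expR (- (c * t))).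
Proof.
apply: posmeasurable_exp; apply: continuous_posmeasurable => x _.
by apply: cvgN; apply: cvgMl_tmp.
Qed.

Lemma posmeasurable_expV c : posmeasurable (fun t => expR (- (c / t))).
Proof.
apply: posmeasurable_exp; apply: continuous_posmeasurable => x x0.
by apply: cvgN; apply: cvgMl_tmp; apply: cvgV => //; rewrite gt_eqF.
Qed.

(** The order of magnitude of the integral of t^(p-1) over [a, 2b], 0 < a <= b:
    the end where the power dominates decides, except at p = 0. *)
Definition powsize p a b :=
  if 0 < p then b `^ p else if p == 0 then 1 + ln (b / a) else a `^ p.

Lemma integral_powR p a b : p != 0 -> 0 < a <= b ->
  (\int[mu]_(t in `[a, b]) (t `^ (p - 1))%:E = ((b `^ p - a `^ p) / p)%:E)%E.
Proof.
move=> p0 /andP[a0 ab].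
have dF x : a <= x <= b ->
    is_derive x (1 : R) (fun t => p^-1 * t `^ p) (x `^ (p - 1)).
  move=> /andP[ax _]; have x0 : 0 < x by exact: lt_le_trans ax.
  apply: (is_derive_eq (is_derive_scale p^-1 _ _ _ (is_derive1_powR p x0))).
  by rewrite mulrA mulVf// mul1r.
rewrite (integral_is_derive _ _ _ _ ab dF) -?mulrBr 1?mulrC//.
by move=> x /andP[ax _]; apply: continuous_powR; exact: lt_le_trans ax.
Qed.

Lemma integral_powR0 a b : 0 < a <= b ->
  (\int[mu]_(t in `[a, b]) (t `^ (0 - 1))%:E = (ln (b / a))%:E)%E.
Proof.
move=> /andP[a0 ab].
have dF x : a <= x <= b -> is_derive x (1 : R) (@ln R) (x `^ (0 - 1)).
  move=> /andP[ax _]; have x0 : 0 < x by exact: lt_le_trans ax.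
  by rewrite sub0r powR_inv1 ?ltW//; exact: is_derive1_ln.
rewrite (integral_is_derive _ _ _ _ ab dF).
  by rewrite ln_div// posrE// (lt_le_trans a0).
by move=> x /andP[ax _]; apply: continuous_powR; exact: lt_le_trans ax.
Qed.

Lemma powsize_gt0 p a b : 0 < a <= b -> 0 < powsize p a b.
Proof.
move=> /andP[a0 ab]; have b0 : 0 < b by exact: lt_le_trans ab.
rewrite /powsize; case: ifP => _; first exact: powR_gt0.
case: ifP => _; last exact: powR_gt0.
by rewrite ltr_pwDl// ln_ge0// ler_pdivlMr// mul1r.
Qed.

Lemma integral_powR_le p : exists2 C : R, 0 < C & forall a b, 0 < a <= b ->
  (\int[mu]_(t in `[a, b]) (t `^ (p - 1))%:E <= (C * powsize p a b)%:E)%E.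
Proof.
have [->|p0] := eqVneq p 0.
  exists 1 => // a b ab; rewrite integral_powR0// lee_fin /powsize ltxx eqxx mul1r.
  by rewrite lerDr.
exists `|p|^-1; first by rewrite invr_gt0 normr_gt0.
move=> a b ab; rewrite integral_powR// lee_fin /powsize (negbTE p0).
case: ifP => pp.
  by rewrite gtr0_norm// mulrC ler_wpM2l ?invr_ge0 ?(ltW pp)// gerBl powR_ge0.
have {}pp : p < 0 by rewrite lt_neqAle p0/= leNgt pp.
rewrite ltr0_norm// -[leLHS]mulrNN -invrN opprB mulrC.
by rewrite ler_wpM2l ?invr_ge0 ?oppr_ge0 ?(ltW pp)// gerBl powR_ge0.
Qed.

(** Over [m, 2m] the power varies by a bounded factor only. *)
Lemma le_integral_dyadic p : exists2 c : R, 0 < c & forall m, 0 < m ->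
  ((c * m `^ p)%:E <= \int[mu]_(t in `[m, (2 * m)%R]) (t `^ (p - 1))%:E)%E.
Proof.
exists (Num.min 1 (2 `^ (p - 1))).
  by rewrite lt_min ltr01 powR_gt0.
move=> m m0; have m2 : m <= 2 * m by rewrite ler_peMl ?ltW// ltr1n.
have mm : (Num.min 1 (2 `^ (p - 1)) * m `^ p)%:E =
  (\int[mu]_(t in `[m, (2 * m)%R]) (cst (Num.min 1 (2 `^ (p - 1)) * m `^ (p - 1)) t)%:E)%E.
  rewrite (integral_is_derive _ _ _ _ m2
    (fun x _ => is_derive_lin (Num.min 1 (2 `^ (p - 1)) * m `^ (p - 1)) x)).
  - rewrite -mulrBr [2 * m - m](_ : _ = m); last by ring.
    rewrite -mulrA -{3}[m]powRr1 ?(ltW m0)// -powRD ?subrK//.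
    by rewrite (gt_eqF m0) implybT.
  - by move=> x _; exact: cvg_cst.
rewrite mm; apply: le_integral_pos => //.
- by apply: sub_pos_itv; rewrite /= bnd_simp.
- exact: posmeasurable_cst.
- exact: posmeasurable_powR.
move=> x /=; rewrite in_itv/= => /andP[mx xm].
have x0 : 0 < x by exact: lt_le_trans mx.
rewrite mulr_ge0 ?powR_ge0 ?le_min ?ler01 ?powR_ge0//=.
have [p1|p1] := leP 0 (p - 1).
  apply: (@le_trans _ _ (1 * m `^ (p - 1))).
    by rewrite ler_wpM2r ?powR_ge0// ge_min lexx.
  by rewrite mul1r ge0_ler_powR// ?nnegrE// ltW.
apply: (@le_trans _ _ (2 `^ (p - 1) * m `^ (p - 1))).
  by rewrite ler_wpM2r ?powR_ge0// ge_min lexx orbT.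
rewrite -powRM ?(ltW m0)// -[p - 1]opprK !(powRN _ (- (p - 1))).
rewrite lef_pV2 ?posrE ?powR_gt0//.
  by rewrite ge0_ler_powR// ?nnegrE ?oppr_ge0 ltW// mulr_gt0.
by rewrite mulr_gt0.
Qed.

Lemma powRB1_ge0_pos p : forall t : R, 0 < t -> 0 <= t `^ (p - 1).
Proof. by move=> t _; exact: powR_ge0. Qed.

(** With 2b as the right end, the bound holds down to a = b, where the
    interval would otherwise be empty. *)
Lemma le_integral_powR p : exists2 c : R, 0 < c & forall a b, 0 < a <= b ->
  ((c * powsize p a b)%:E <= \int[mu]_(t in `[a, (2 * b)%R]) (t `^ (p - 1))%:E)%E.
Proof.
have [c c0 hc] := le_integral_dyadic p.
have [p0|p0] := eqVneq p 0.
  have l20 : 0 < ln 2 :> R by apply: ln_gt0; rewrite ltr1n.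
  exists (Num.min 1 (ln 2)); first by rewrite lt_min ltr01.
  move=> a b /andP[a0 ab]; have b0 : 0 < b by exact: lt_le_trans ab.
  rewrite p0 integral_powR0; last first.
    by rewrite a0/= (le_trans ab)// ler_peMl ?(ltW b0)// ler1n.
  rewrite lee_fin /powsize ltxx eqxx -mulrA [ln (2 * _)]lnM ?posrE// ?divr_gt0//.
  have : 0 <= ln (b / a) by rewrite ln_ge0// ler_pdivlMr// mul1r.
  by rewrite mulrDr mulr1 => h; apply: lerD; rewrite ?ge_min ?lexx ?orbT// ler_piMl// ge_min lexx.
exists c => // a b /andP[a0 ab]; have b0 : 0 < b by exact: lt_le_trans ab.
have b2 : b <= 2 * b by rewrite ler_peMl ?(ltW b0)// ler1n.
have sub : `[a, 2 * b] `<=` (`]0, +oo[ : set R).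
  by apply: sub_pos_itv; rewrite /= bnd_simp.
rewrite /powsize (negbTE p0); case: ifP => pp; apply: (le_trans (hc _ _)) => //;
  apply: le_integral_sub => //; try exact: posmeasurable_powR; try exact: powRB1_ge0_pos.
- by apply: subset_itvr; rewrite bnd_simp.
- by apply: subset_itvl; rewrite bnd_simp ler_pM2l.
Qed.

Lemma integral_powR_0_le p b : 0 < p -> 0 < b ->
  (\int[mu]_(t in `]0%R, b]) (t `^ (p - 1))%:E <= (p^-1 * b `^ p)%:E)%E.
Proof.
move=> p0 b0; apply: integral_oc_le => //; first exact: posmeasurable_powR.
  exact: powRB1_ge0_pos.
move=> a ab; rewrite integral_powR ?gt_eqF// lee_fin mulrC.
by rewrite ler_wpM2l ?invr_ge0 ?(ltW p0)// gerBl powR_ge0.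
Qed.

(** The factor exp(-ca/t) cuts the power off below t = a: there it beats every
    power of t/a, in particular one that makes the integrand bounded. *)
Lemma integral_powR_exp_le p c : 0 < c -> exists2 C : R, 0 < C &
  forall a b, 0 < a <= b ->
  (\int[mu]_(t in `]0%R, b]) (t `^ (p - 1) * expR (- (c * a / t)))%:E <=
     (C * powsize p a b)%:E)%E.
Proof.
move=> c0.
have [C1 C10 hC1] := @integral_powR_le p.
pose N := `|p| + 1.
have N0 : 0 <= N by rewrite addr_ge0.
have [C2 C20 hC2] := @powR_le_expR R N c N0 c0.
exists (C2 + C1); first by rewrite addr_gt0.
move=> a b /andP[a0 ab]; have b0 : 0 < b by exact: lt_le_trans ab.
have mf : posmeasurable (fun t : R => t `^ (p - 1) * expR (- (c * a / t))).
  apply: posmeasurableM; [exact: posmeasurable_powR|exact: posmeasurable_expV].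
have f0 (t : R) : 0 < t -> 0 <= t `^ (p - 1) * expR (- (c * a / t)).
  by move=> _; rewrite mulr_ge0 ?powR_ge0 ?expR_ge0.
rewrite (@integral_oc_split _ _ a b) ?a0// mulrDl EFinD; apply: leeD.
- apply: (@le_trans _ _ (\int[mu]_(t in `]0%R, a]) ((C2 * a `^ (p - 1)) * t `^ (1 - 1))%:E)%E).
    apply: le_integral_pos => //.
    + by apply: sub_pos_itv; rewrite /= bnd_simp.
    + apply: posmeasurableM; first exact: posmeasurable_cst.
      exact: posmeasurable_powR.
    move=> t /=; rewrite in_itv/= => /andP[t0 ta].
    rewrite f0//= subrr powRr0 mulr1.
    rewrite expRN ler_pdivrMr ?expR_gt0//.
    have at0 : 0 < a / t by rewrite divr_gt0.
    apply: (@le_trans _ _ (a `^ (p - 1) * (a / t) `^ N)); last first.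
      rewrite [C2 * _]mulrC -[leRHS]mulrA ler_wpM2l ?powR_ge0//.
      by rewrite -[c * a / t]mulrA hC2// ltW.
    have {1}-> : t = a * (a / t)^-1 by rewrite invf_div mulrCA divff ?mulr1// gt_eqF.
    rewrite powRM ?invr_ge0 ?(ltW a0) ?(ltW at0)// ler_pM2l ?powR_gt0//.
    rewrite -powR_inv1 ?(ltW at0)// -powRrM; apply: ler_powR.
      by rewrite ler_pdivlMr// mul1r.
    rewrite /N mulN1r opprB addrC lerD2r//.
    by rewrite (le_trans (ler_norm _))// normrN.
  rewrite integral_posZ//; last 4 first.
    + by apply: sub_pos_itv; rewrite /= bnd_simp.
    + exact: posmeasurable_powR.
    + exact: powRB1_ge0_pos.
    + by rewrite mulr_ge0 ?powR_ge0// ltW.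
  apply: (@le_trans _ _ ((C2 * a `^ (p - 1))%:E * (1^-1 * a `^ 1)%:E)%E).
    rewrite lee_wpmul2l//; first by rewrite lee_fin mulr_ge0 ?powR_ge0// ltW.
    exact: integral_powR_0_le.
  rewrite -EFinM lee_fin invr1 mul1r -mulrA ler_pM2l//.
  rewrite -powRD ?(gt_eqF a0) ?implybT// subrK /powsize.
  case: ifP => p0; first by rewrite ge0_ler_powR// ?nnegrE ltW.
  case: eqP => // ->; rewrite powRr0 lerDl ln_ge0//.
  by rewrite ler_pdivlMr// mul1r.
- apply: le_trans (hC1 a b _); rewrite ?a0//.
  apply: le_integral_pos => //.
  + by apply: sub_pos_itv; rewrite /= bnd_simp.
  + exact: posmeasurable_powR.
  move=> t /=; rewrite in_itv/= => /andP[at_ tb].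
  have t0 : 0 < t by exact: lt_le_trans at_.
  rewrite f0//= ler_piMr ?powR_ge0// -expR0 ler_expR oppr_le0.
  by rewrite divr_ge0// ?mulr_ge0// ltW.
Qed.

Lemma integral_expR_tail_le p c : 0 < c -> exists2 C : R, 0 < C &
  (\int[mu]_(t in `[1%R, +oo[) (expR (- (c * t)) * t `^ p)%:E <= C%:E)%E.
Proof.
move=> c0.
have [C C0 hC] := @powR_le_expR R `|p| (c / 2) (normr_ge0 _) (divr_gt0 c0 (ltr0Sn _ _)).
exists (C * (2 / c)); first by rewrite mulr_gt0// divr_gt0.
have sub (b : itv_bound R) : [set` Interval (BLeft 1) b] `<=` (`]0, +oo[ : set R).
  by apply: sub_pos_itv; rewrite /= bnd_simp.
have mg : posmeasurable (fun t : R => expR (- (c / 2 * t))) by exact: posmeasurable_expN.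
apply: (@le_trans _ _ (\int[mu]_(t in `[1%R, +oo[) (C * expR (- (c / 2 * t)))%:E)%E).
  apply: le_integral_pos => //.
  + by apply: posmeasurableM; [exact: posmeasurable_expN|exact: posmeasurable_powR].
  + by apply: posmeasurableM; [exact: posmeasurable_cst|].
  move=> t /=; rewrite in_itv/= andbT => t1.
  rewrite mulr_ge0 ?expR_ge0 ?powR_ge0//=.
  apply: (@le_trans _ _ (expR (- (c * t)) * (C * expR (c / 2 * t)))).
    rewrite ler_wpM2l ?expR_ge0// (le_trans _ (hC t _))//; last by rewrite (le_trans _ t1).
    by apply: ler_powR => //; exact: ler_norm.
  rewrite mulrCA -expRD; suff -> : - (c * t) + c / 2 * t = - (c / 2 * t) by [].
  by field.
rewrite integral_posZ ?(ltW C0)//.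
rewrite EFinM; apply: lee_wpmul2l; first by rewrite lee_fin ltW.
apply: integral_cy_le => //.
move=> b b1.
have dF x : 1 <= x <= b ->
    is_derive x (1 : R) (fun t => - (2 / c) * expR (- (c / 2) * t))
      (expR (- (c / 2 * x))).
  move=> _; apply: (is_derive_eq (is_derive_scale _ _ _ _ (is_derive_expRM _ x))).
  rewrite mulrA mulrNN mulNr [2 / c * _](_ : _ = 1) ?mul1r//; field.
  by rewrite gt_eqF.
rewrite (integral_is_derive _ _ _ _ b1 dF).
  rewrite lee_fin !mulNr opprK addrC -mulrBr ler_piMr ?divr_ge0 ?(ltW c0)//.
  rewrite lerBlDr ler_wpDr ?expR_ge0// -expR0 ler_expR oppr_le0.
  by rewrite mulr_ge0// divr_ge0// ltW.
by move=> x _; apply: is_derive_continuous.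
Qed.

End PowerIntegrals.

(** * Euler's Gamma function *)

Section GammaFunction.
Context {R : realType}.
Local Open Scope classical_set_scope.
Notation mu := (@lebesgue_measure R).
Implicit Types (s : R).

Let integrand s (t : R) := expR (- t) * t `^ (s - 1).

Let integrand_ge0 s t : 0 < t -> 0 <= integrand s t.
Proof. by move=> _; rewrite mulr_ge0 ?expR_ge0 ?powR_ge0. Qed.

Let measurable_integrand s : posmeasurable (integrand s).
Proof.
apply: posmeasurableM; last exact: posmeasurable_powR.
by have := @posmeasurable_expN R 1; under eq_fun do rewrite mul1r.
Qed.

Let pos_integral_fin s : 0 < s -> exists2 C : R, 0 < C &
  (\int[mu]_(t in `]0%R, +oo[) (expR (- t) * t `^ (s - 1))%:E <= C%:E)%E.
Proof.
move=> s0; have [C C0 hC] := @integral_expR_tail_le R (s - 1) 1 ltr01.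
exists (s^-1 + C); first by rewrite addr_gt0// invr_gt0.
rewrite (integral_pos_split _ 1 ltr01 (measurable_integrand s) (integrand_ge0 s)).
rewrite EFinD; apply: leeD.
  have := integral_powR_0_le s 1 s0 (@ltr01 R); rewrite powR1 mulr1.
  apply: le_trans; apply: le_integral_pos => //.
  - by apply: sub_pos_itv; rewrite /= bnd_simp.
  - exact: posmeasurable_powR.
  move=> t /=; rewrite in_itv/= => /andP[t0 _]; rewrite integrand_ge0//=.
  rewrite ler_piMl ?powR_ge0// -expR0 ler_expR oppr_le0; exact: ltW.
by move: hC; under eq_integral do rewrite mul1r.
Qed.

Let posE s : 0 < s -> (0 < \int[mu]_(t in `]0%R, +oo[) (integrand s t)%:E)%E.
Proof.
move=> s0; have [c c0 hc] := @le_integral_dyadic R s.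
have sub : `[1, 2 * 1] `<=` (`]0, +oo[ : set R).
  by apply: sub_pos_itv; rewrite /= bnd_simp.
apply: (@lt_le_trans _ _ ((expR (- 2))%:E * (c * 1 `^ s)%:E)%E).
  by rewrite powR1 mulr1 -EFinM lte_fin mulr_gt0// expR_gt0.
apply: (@le_trans _ _ ((expR (- 2))%:E *
    \int[mu]_(t in `[1%R, (2 * 1)%R]) (t `^ (s - 1))%:E)%E).
  by apply: lee_wpmul2l; [rewrite lee_fin expR_ge0|exact: hc].
rewrite -(integral_posZ _ _ _ (measurable_itv _) sub (posmeasurable_powR _)
  (powRB1_ge0_pos s) (expR_ge0 _)).
apply: (@le_trans _ _ (\int[mu]_(t in `[1%R, (2 * 1)%R]) (integrand s t)%:E)%E).
  apply: le_integral_pos => //.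
    apply: posmeasurableM; first exact: posmeasurable_cst.
    exact: posmeasurable_powR.
  move=> t /=; rewrite in_itv/= mulr1 => /andP[_ t2].
  rewrite mulr_ge0 ?expR_ge0 ?powR_ge0//= ler_wpM2r ?powR_ge0// ler_expR lerN2.
  exact: t2.
by apply: le_integral_sub => //; exact: integrand_ge0.
Qed.

Lemma GammaE s : 0 < s ->
  (\int[mu]_(t in `]0%R, +oo[) (expR (- t) * t `^ (s - 1))%:E = (Gamma s)%:E)%E.
Proof.
move=> s0; have [C C0 hC] := pos_integral_fin s s0.
rewrite /Gamma /Rintegral fineK// ge0_fin_numE.
  exact: le_lt_trans hC (ltry _).
exact/ltW/posE.
Qed.

Lemma Gamma_gt0 s : 0 < s -> 0 < Gamma s.
Proof. by move=> s0; rewrite -lte_fin -GammaE//; exact: posE. Qed.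

Let I (n : nat) : set R := `[n.+1%:R^-1, n.+1%:R].

Let bigcupI : \bigcup_n I n = `]0, +oo[.
Proof.
apply/seteqP; split => x /=.
  move=> [n _]; rewrite /I/= !in_itv/= andbT => /andP[+ _].
  by apply: lt_le_trans; rewrite invr_gt0.
rewrite in_itv/= andbT => x0.
pose n := maxn (Num.truncn x) (Num.truncn x^-1).
exists n => //; rewrite /I/= in_itv/=; apply/andP; split.
  rewrite invf_ple ?posrE// (le_trans (ltW (truncnS_gt _)))//.
  by rewrite ler_nat ltnS leq_maxr.
rewrite (le_trans (ltW (truncnS_gt _)))//.
by rewrite ler_nat ltnS leq_maxl.
Qed.

Let ndI : nondecreasing_seq I.
Proof.
move=> m n mn; rewrite subsetEset => x; rewrite /I/= !in_itv/= => /andP[mx xm].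
rewrite (le_trans _ mx)/= ?(le_trans xm) ?ler_nat//.
by rewrite lef_pV2 ?posrE// ler_nat.
Qed.

Let subI n : I n `<=` `]0, +oo[.
Proof. by apply: sub_pos_itv; rewrite /= bnd_simp invr_gt0. Qed.

Let mI n : @measurable _ (measurableTypeR R) (I n).
Proof. exact: measurable_itv. Qed.

Let cvg_Gamma s : 0 < s ->
  (\int[mu]_(t in I n) integrand s t)%R @[n --> \oo] --> Gamma s.
Proof.
move=> s0; apply: fine_cvg; rewrite -GammaE// -bigcupI.
apply: ge0_nondecreasing_set_cvg_integral => //; try exact: mI.
- move=> i; apply/measurable_EFinP; exact: (posmeasurableS _ _ (mI i) (@subI i)).
- by move=> i x /subI; rewrite /= in_itv/= andbT lee_fin; exact: integrand_ge0.
Qed.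

Let continuous_integrand s x : 0 < x -> {for x, continuous (integrand s)}.
Proof.
move=> x0; apply: (@cvgM _ _ _ _ (fun t => expR (- t)) (fun t => t `^ (s - 1))).
  apply: (@continuous_comp _ _ _ (-%R) expR); first exact: opp_continuous.
  exact: continuous_expR.
exact: continuous_powR.
Qed.

Let integrableI s n : mu.-integrable (I n) (EFin \o integrand s).
Proof.
apply: continuous_compact_integrable; first exact: segment_compact.
apply: continuous_in_subspaceT => x; rewrite inE => /subI.
by rewrite /= in_itv/= andbT; exact: continuous_integrand.
Qed.

(** The limit of integration by parts over [1/(n+1), n+1]. *)
Lemma GammaD1 s : 0 < s -> Gamma (s + 1) = s * Gamma s.
Proof.
move=> s0.
pose bd (t : R) := expR (- t) * t `^ s.
have parts n : (\int[mu]_(t in I n) integrand (s + 1) t)%R =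
    s * (\int[mu]_(t in I n) integrand s t)%R - (bd n.+1%:R - bd n.+1%:R^-1).
  have e n' t : I n' t -> 0 < t by move=> /subI; rewrite /= in_itv/= andbT.
  have dbd (t : R) : 0 < t ->
      is_derive t (1 : R) bd (s * integrand s t - integrand (s + 1) t).
    move=> t0; have := is_derive_mul (fun t => expR (- 1 * t)) (fun t => t `^ s)
      t _ _ (is_derive_expRM (-1) t) (is_derive1_powR s t0).
    under eq_fun do rewrite mulN1r; move/is_derive_eq; apply.
    by rewrite /integrand addrK !mulN1r; ring.
  rewrite -(RintegralZl s (mI n) (integrableI s n)).
  apply/eqP; rewrite eq_sym subr_eq addrC -subr_eq; apply/eqP.
  rewrite -(RintegralB (mI n) (integrableZl (mI n) s (integrableI s n)) (integrableI (s + 1) n)).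
  have n1 : n.+1%:R^-1 <= n.+1%:R :> R.
    by rewrite (@le_trans _ _ 1)// ?ler1n// invf_le1// ?ler1n.
  apply: EFin_inj; rewrite /Rintegral.
  rewrite (integral_is_derive _ _ _ _ n1 (fun t ht => dbd t _))//.
  - move=> t ht; apply: (e n); rewrite /I/= in_itv/=; exact: ht.
  - move=> t ht; have t0 : 0 < t by apply: (e n); rewrite /I/= in_itv/=; exact: ht.
    by apply: cvgB; [apply: cvgMl_tmp|]; exact: continuous_integrand.
have bdy : bd n.+1%:R @[n --> \oo] --> 0.
  have [C C0 hC] := @powR_le_expR R (s + 1) 1 (addr_ge0 (ltW s0) ler01) ltr01.
  apply: (@squeeze_cvgr _ _ _ _ (cst 0) (fun n => C * harmonic n)).
  - apply: nearW => n; rewrite /bd /= mulr_ge0 ?expR_ge0 ?powR_ge0//=.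
    rewrite expRN mulrC ler_pdivrMr ?expR_gt0// mulrAC ler_pdivlMr//.
    have := hC n.+1%:R (ler0n _ _); rewrite mul1r powRD ?powRr1//.
    by apply/implyP => _.
  - exact: cvg_cst.
  - by rewrite -(mulr0 C); apply: cvgMl_tmp; exact: cvg_harmonic.
have bd0 : bd n.+1%:R^-1 @[n --> \oo] --> 0.
  apply: (@squeeze_cvgr _ _ _ _ (cst 0) (fun n => n.+1%:R^-1 `^ s)).
  - apply: nearW => n; rewrite /bd /= mulr_ge0 ?expR_ge0 ?powR_ge0//=.
    by rewrite ler_piMl ?powR_ge0// -expR0 ler_expR oppr_le0.
  - exact: cvg_cst.
  - move: (@powR_cvg0 R s s0) => /cvg_at_rightP; apply; split => //.
    exact: cvg_harmonic.
have h1 : (\int[mu]_(t in I n) integrand (s + 1) t)%R @[n --> \oo] --> s * Gamma s.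
  rewrite -[s * _]subr0 -[X in _ - X](subr0 0); under eq_cvg do rewrite parts.
  by apply: cvgB; [apply: cvgMl_tmp; exact: cvg_Gamma|exact: cvgB].
have h2 := cvg_Gamma (s + 1) (addr_gt0 s0 ltr01).
exact: (cvg_unique _ h2 h1).
Qed.

End GammaFunction.

(** * The power series of the Bessel functions *)

Section BesselSeries.
Context {R : realType}.
Local Open Scope classical_set_scope.
Implicit Types (beta w z : R).

Definition bessel_coef beta (k : nat) : R :=
  (k`!%:R * Gamma (k%:R + beta + 1))^-1.

(** As a function phi of w it satisfies I_beta(z) = (z/2)^beta phi((z/2)^2). *)
Definition bessel_entire beta w : R := limn (pseries (bessel_coef beta) w).

Local Opaque Gamma.

Let Gamma_arg_gt0 beta k : - 1 < beta -> 0 < k%:R + beta + 1.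
Proof. by move=> b1; have : 0 <= k%:R :> R by []; lra. Qed.

Lemma bessel_coef_gt0 beta k : - 1 < beta -> 0 < bessel_coef beta k.
Proof.
move=> b1; rewrite invr_gt0 mulr_gt0 ?ltr0n ?fact_gt0//.
exact/Gamma_gt0/Gamma_arg_gt0.
Qed.

Let Gamma_lb beta : - 1 < beta ->
  exists2 m : R, 0 < m & forall k : nat, m <= Gamma (k%:R + beta + 1).
Proof.
move=> b1; pose g k := Gamma (k%:R + beta + 1).
have g0 k : 0 < g k by exact/Gamma_gt0/Gamma_arg_gt0.
have gS k : g k.+1 = (k%:R + beta + 1) * g k.
  apply: etrans (GammaD1 _ (Gamma_arg_gt0 _ k b1)); congr Gamma.
  by rewrite -[in LHS]natr1; ring.
suff [m m0 hm] : exists2 m : R, 0 < m & forall k, m <= g k by exists m.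
clearbody g; exists (Num.min (g 0) (g 1)); first by rewrite lt_min !g0.
elim=> [|[|k] ih]; first by rewrite ge_min lexx.
  by rewrite ge_min lexx orbT.
rewrite (le_trans ih)// (gS k.+1) ler_peMl ?(ltW (g0 _))//.
by rewrite -natr1; have : 0 <= k%:R :> R by []; lra.
Qed.

(** The Gamma factors are bounded below, so the exponential series dominates. *)
Lemma cvg_bessel beta w : - 1 < beta -> cvgn (pseries (bessel_coef beta) w).
Proof.
move=> b1; have [m m0 hm] := Gamma_lb beta b1.
apply: normed_cvg.
apply: (@series_le_cvg _ _ (fun k => m^-1 * (`|w| ^+ k / k`!%:R))).
- by move=> k; exact: normr_ge0.
- by move=> k; rewrite mulr_ge0 ?invr_ge0 ?(ltW m0)// divr_ge0 ?exprn_ge0.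
- move=> k /=; rewrite normrM normrX (gtr0_norm (bessel_coef_gt0 _ k b1)).
  rewrite [leRHS]mulrCA mulrC ler_wpM2l ?exprn_ge0// /bessel_coef invfM mulrC.
  rewrite ler_wpM2r ?invr_ge0// lef_pV2 ?posrE ?m0 ?hm//.
  exact/Gamma_gt0/Gamma_arg_gt0.
- have := @is_cvg_seriesZ _ _ m^-1 (@is_cvg_series_exp_coeff R `|w|).
  by rewrite (_ : _ *: _ = (fun k => m^-1 * (`|w| ^+ k / k`!%:R))).
Qed.

Let diffs_bessel beta :
  pseries_diffs (bessel_coef beta) = bessel_coef (beta + 1).
Proof.
apply/funext => k.
have e : k.+1%:R + beta + 1 = k%:R + (beta + 1) + 1 by rewrite -natr1; ring.
rewrite /pseries_diffs /bessel_coef e factS natrM; move: (Gamma _) => g.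
by rewrite -mulrA invfM mulrA mulfV ?mul1r// pnatr_eq0.
Qed.

Lemma is_derive_bessel beta w : - 1 < beta ->
  is_derive w (1 : R) (bessel_entire beta) (bessel_entire (beta + 1) w).
Proof.
move=> b1; have b2 : - 1 < beta + 1 by lra.
have b3 : - 1 < beta + 1 + 1 by lra.
rewrite /bessel_entire -diffs_bessel.
apply: (@pseries_snd_diffs _ _ (`|w| + 1)); rewrite ?diffs_bessel; try exact: cvg_bessel.
by rewrite [X in _ < X]ger0_norm ?ltrDl// addr_ge0.
Qed.

(** Since Gamma(k+beta+2) = (k+beta+1) Gamma(k+beta+1), the coefficient of w^k
    splits into the parts of beta+1 and of k. *)
Lemma bessel_recurrence beta w : - 1 < beta ->
  bessel_entire beta w =
  (beta + 1) * bessel_entire (beta + 1) w + w * bessel_entire (beta + 1 + 1) w.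
Proof.
move=> b1; have b2 : - 1 < beta + 1 by lra.
have b3 : - 1 < beta + 1 + 1 by lra.
have h1 : pseries (bessel_coef (beta + 1)) w @ \oo --> bessel_entire (beta + 1) w.
  exact: cvg_bessel.
have h2 : series (fun i => i%:R * bessel_coef (beta + 1) i * w ^+ i.-1) @ \oo -->
    bessel_entire (beta + 1 + 1) w.
  rewrite /bessel_entire -[bessel_coef (beta + 1 + 1)]diffs_bessel.
  apply: pseries_diffs_equiv.
  by rewrite diffs_bessel; exact: cvg_bessel.
apply: cvg_lim => //.
rewrite (_ : pseries _ _ = fun n => (beta + 1) * pseries (bessel_coef (beta + 1)) w n +
    w * series (fun i => i%:R * bessel_coef (beta + 1) i * w ^+ i.-1) n).
  by apply: cvgD; [exact: cvgMl_tmp h1|exact: cvgMl_tmp h2].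
apply/funext => n.
rewrite /pseries /series/= !mulr_sumr -big_split/=; apply: eq_bigr => k _.
have -> : w * (k%:R * bessel_coef (beta + 1) k * w ^+ k.-1) =
    k%:R * bessel_coef (beta + 1) k * w ^+ k.
  case: k => [|k]; first by rewrite !mul0r mulr0.
  by rewrite exprS/=; ring.
rewrite mulrA -mulrDl; congr (_ * _).
rewrite -mulrDl /bessel_coef [k%:R + (beta + 1) + 1](_ : _ = k%:R + beta + 1 + 1); last ring.
rewrite (GammaD1 (k%:R + beta + 1)) ?Gamma_arg_gt0//.
have g0 : Gamma (k%:R + beta + 1) != 0 by rewrite gt_eqF// Gamma_gt0// Gamma_arg_gt0.
have k0 : k`!%:R != 0 :> R by rewrite pnatr_eq0 -lt0n fact_gt0.
have a0 : k%:R + beta + 1 != 0 by rewrite gt_eqF// Gamma_arg_gt0.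
by field; rewrite g0 k0 a0.
Qed.

Lemma bessel_entire_gt0 beta w : - 1 < beta -> 0 <= w -> 0 < bessel_entire beta w.
Proof.
move=> b1 w0; apply: (@lt_le_trans _ _ (bessel_coef beta 0)).
  exact: bessel_coef_gt0.
apply: limr_ge; first exact: cvg_bessel.
near=> n; rewrite /pseries /series/=.
have n0 : (0 < n)%N by near: n; exists 1%N.
rewrite (big_ltn n0) expr0 mulr1 lerDl sumr_ge0// => k _.
by rewrite mulr_ge0 ?exprn_ge0// ltW// bessel_coef_gt0.
Unshelve. all: by end_near. Qed.

Lemma besselIE beta z : - 1 < beta -> 0 < z ->
  besselI beta z = (z / 2) `^ beta * bessel_entire beta ((z / 2) ^+ 2).
Proof.
move=> b1 z0; apply: cvg_lim => //.
rewrite (_ : series _ = fun n => (z / 2) `^ beta *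
    pseries (bessel_coef beta) ((z / 2) ^+ 2) n).
  by apply: cvgMl_tmp; exact: cvg_bessel.
apply/funext => n.
rewrite /pseries /series/= mulr_sumr; apply: eq_bigr => k _.
have z2 : 0 < z / 2 by rewrite divr_gt0.
rewrite powRD ?(gt_eqF z2) ?implybT// powR_mulrn ?(ltW z2)//.
by rewrite /bessel_coef -muln2 mulnC exprM; ring.
Qed.

End BesselSeries.

(** * Growth of the Bessel functions *)

Section BesselGrowth.
Context {R : realType}.
Local Open Scope classical_set_scope.
Context (alpha : R) (halpha : - 2^-1 < alpha).
Let kappa := alpha + 2^-1.
Implicit Types z : R.

Let kappa0 : 0 < kappa. Proof. by rewrite /kappa -ltrBlDr sub0r. Qed.
Let a1 : - 1 < alpha. Proof. by move: halpha => ?; lra. Qed.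
Let a2 : - 1 < alpha + 1. Proof. by move: halpha => ?; lra. Qed.

(** Up to the factor 2^alpha these are z^(-alpha) I_alpha(z) and
    z^(-alpha) I_(alpha+1)(z). *)
Definition bessel_even z := bessel_entire alpha ((z / 2) ^+ 2).
Definition bessel_odd z := z / 2 * bessel_entire (alpha + 1) ((z / 2) ^+ 2).
Definition bessel_plus z := bessel_even z + bessel_odd z.
Definition bessel_minus z := bessel_even z - bessel_odd z.

Let phi1 z := bessel_entire (alpha + 1) ((z / 2) ^+ 2).

Let dsq z : is_derive z (1 : R) (fun t => (t / 2) ^+ 2) (z / 2).
Proof.
have h := is_derive_lin (2^-1) z.
have := is_derive_mul _ _ _ _ _ h h.
rewrite (_ : (fun t => _) = (fun t => (t / 2) ^+ 2)); last first.
  by apply/funext => t; rewrite expr2 ![2^-1 * _]mulrC.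
by move/is_derive_eq; apply; field.
Qed.

Let deven z : is_derive z (1 : R) bessel_even (bessel_odd z).
Proof.
apply: is_derive_eq (is_derive_comp _ _ _ _ _ (is_derive_bessel _ _ a1) (dsq z)) _.
by rewrite mulrC.
Qed.

Let dodd z : is_derive z (1 : R) bessel_odd (bessel_even z - kappa * phi1 z).
Proof.
have h := is_derive_lin (2^-1) z.
have := is_derive_mul _ _ _ _ _ h
  (is_derive_comp _ _ _ _ _ (is_derive_bessel _ _ a2) (dsq z)).
rewrite (_ : (fun t => _) = bessel_odd); last first.
  by apply/funext => t; rewrite /bessel_odd [2^-1 * _]mulrC.
move/is_derive_eq; apply.
rewrite /bessel_even /phi1 (bessel_recurrence _ _ a1) /kappa.
move: (bessel_entire _ _) (bessel_entire _ _) => x y.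
by field.
Qed.

Let dplus z : is_derive z (1 : R) bessel_plus (bessel_plus z - kappa * phi1 z).
Proof.
apply: is_derive_eq (is_derive_add _ _ _ _ _ (deven z) (dodd z)) _.
by rewrite /bessel_plus; ring.
Qed.

Let dminus z : is_derive z (1 : R) bessel_minus (kappa * phi1 z - bessel_minus z).
Proof.
apply: is_derive_eq (is_derive_sub _ _ _ _ _ (deven z) (dodd z)) _.
by rewrite /bessel_minus; ring.
Qed.

Let phi1E z : z * phi1 z = bessel_plus z - bessel_minus z.
Proof.
rewrite /bessel_plus /bessel_minus /bessel_odd -/(phi1 z).
by move: (phi1 z) (bessel_even z) => x y; field.
Qed.

Lemma continuous_bessel_plus z : {for z, continuous bessel_plus}.
Proof. exact: is_derive_continuous (dplus z). Qed.

Lemma continuous_bessel_minus z : {for z, continuous bessel_minus}.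
Proof. exact: is_derive_continuous (dminus z). Qed.

Let odd_ge0 z : 0 <= z -> 0 <= bessel_odd z.
Proof.
by move=> z0; rewrite mulr_ge0 ?divr_ge0// ltW// bessel_entire_gt0// sqr_ge0.
Qed.

Lemma bessel_plus_gt0 z : 0 <= z -> 0 < bessel_plus z.
Proof.
move=> z0; rewrite ltr_pwDl ?odd_ge0//.
by rewrite bessel_entire_gt0// sqr_ge0.
Qed.

Let minus_le_plus z : 0 <= z -> bessel_minus z <= bessel_plus z.
Proof.
by move=> /odd_ge0; rewrite /bessel_minus /bessel_plus; lra.
Qed.

(** With these weights the linear system for the two solutions becomes
    off-diagonal, with positive coefficients. *)
Let P z := z `^ kappa * expR z * bessel_minus z.
Let Q z := z `^ kappa * expR (- z) * bessel_plus z.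
Let S z := expR (2 * z) / z.

Let dexp (k z : R) : is_derive z (1 : R) (fun t => expR (k * t)) (k * expR (k * z)).
Proof. exact: is_derive_expRM. Qed.

Let powE z : 0 < z -> z `^ (kappa - 1) = z `^ kappa / z.
Proof.
by move=> z0; rewrite powRB ?(gt_eqF z0) ?implybT// powRr1// ltW.
Qed.

Let exp2E z : expR (2 * z) = expR z ^+ 2.
Proof. by rewrite mulr_natl mulr2n expRD expr2. Qed.

Let dP z : 0 < z -> is_derive z (1 : R) P (kappa * S z * Q z).
Proof.
move=> z0; have d1 := is_derive_mul _ _ _ _ _ (is_derive1_powR kappa z0) (is_derive_expR z).
apply: is_derive_eq (is_derive_mul _ _ _ _ _ d1 (dminus z)) _.
rewrite /S /Q exp2E expRN powE//.
have -> : bessel_plus z = z * phi1 z + bessel_minus z by rewrite phi1E; ring.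
have e0 : expR z != 0 by rewrite gt_eqF// expR_gt0.
move: (phi1 z) (bessel_minus z) (z `^ kappa) (expR z) e0 => x y u v e0.
by field; rewrite e0 gt_eqF.
Qed.

Let dQ z : 0 < z -> is_derive z (1 : R) Q (kappa / z * expR (- (2 * z)) * P z).
Proof.
move=> z0; have dN : is_derive z (1 : R) (fun t => expR (- t)) (- expR (- z)).
  have := dexp (-1) z; under eq_fun do rewrite mulN1r.
  by rewrite !mulN1r.
have d1 := is_derive_mul _ _ _ _ _ (is_derive1_powR kappa z0) dN.
apply: is_derive_eq (is_derive_mul _ _ _ _ _ d1 (dplus z)) _.
rewrite /P !expRN exp2E powE//.
have -> : bessel_plus z = z * phi1 z + bessel_minus z by rewrite phi1E; ring.
have e0 : expR z != 0 by rewrite gt_eqF// expR_gt0.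
move: (phi1 z) (bessel_minus z) (z `^ kappa) (expR z) e0 => x y u v e0.
by field; rewrite e0 gt_eqF.
Qed.

Let dinv z : z != 0 -> is_derive z (1 : R) (fun t => t^-1) (- z ^- 2).
Proof.
move=> z0; apply: is_derive_eq (@is_deriveV _ id z 1 1 z0 _) _.
by rewrite /GRing.scale/= mulr1.
Qed.

Let dS z : 0 < z -> is_derive z (1 : R) S ((2 - z^-1) * S z).
Proof.
move=> z0; have z1 : z != 0 by rewrite gt_eqF.
apply: is_derive_eq (is_derive_mul _ _ _ _ _ (dexp 2 z) (dinv z z1)) _.
by rewrite /S; move: (expR _) => v; field.
Qed.

(** At 0 the odd part vanishes, so the difference is positive nearby; from there
    on its multiple P increases. *)
Lemma bessel_minus_gt0 z : 0 <= z -> 0 < bessel_minus z.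
Proof.
have m0 : 0 < bessel_minus 0.
  rewrite /bessel_minus /bessel_odd !mul0r subr0.
  by rewrite bessel_entire_gt0// sqr_ge0.
have /cvgrPdist_lt/(_ _ m0)[/= d d0 hd] := continuous_bessel_minus 0.
have small z' : 0 <= z' < d -> 0 < bessel_minus z'.
  move=> /andP[z'0 z'd].
  have := hd z'; rewrite /ball_/= sub0r normrN ger0_norm// => /(_ z'd).
  by rewrite ltr_norml => /andP[_]; rewrite ltrBlDr ltrDl.
move=> z0; have [zd|dz] := ltP z d; first by apply: small; rewrite z0.
have d2 : 0 < d / 2 by rewrite divr_gt0.
have P0 : 0 < P (d / 2).
  rewrite !mulr_gt0 ?powR_gt0 ?expR_gt0//; apply: small.
  by rewrite ltW//= ltr_pdivrMr// ltr_pMr// ltr1n.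
have z1 : 0 < z by exact: lt_le_trans dz.
have : P (d / 2) <= P z.
  apply: (@nondecreasing_is_derive _ (d / 2) P (fun t => kappa * S t * Q t)) => //.
  - by move=> x xd; apply: dP; exact: lt_le_trans xd.
  - move=> x xd; have x0 : 0 < x by exact: lt_le_trans xd.
    rewrite /S /Q !mulr_ge0 ?expR_ge0 ?powR_ge0 ?invr_ge0 ?(ltW kappa0) ?(ltW x0)//.
    by rewrite ltW// bessel_plus_gt0// ltW.
  - by rewrite (le_trans _ dz)// ler_pdivrMr// ler_pMr// ler1n.
move=> /(lt_le_trans P0); rewrite /P pmulr_rgt0//.
by rewrite mulr_gt0 ?powR_gt0 ?expR_gt0.
Qed.

Let P_gt0 z : 0 < z -> 0 < P z.
Proof.
move=> z0; rewrite !mulr_gt0 ?powR_gt0 ?expR_gt0//.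
by apply: bessel_minus_gt0; exact: ltW.
Qed.

Let Q_gt0 z : 0 < z -> 0 < Q z.
Proof.
move=> z0; rewrite !mulr_gt0 ?powR_gt0 ?expR_gt0//.
by apply: bessel_plus_gt0; exact: ltW.
Qed.

Let S_gt0 z : 0 < z -> 0 < S z.
Proof. by move=> z0; rewrite divr_gt0// expR_gt0. Qed.

Let Q_lb z : 1 <= z -> Q 1 <= Q z.
Proof.
apply: (@nondecreasing_is_derive _ 1 Q (fun t => kappa / t * expR (- (2 * t)) * P t)) => //.
- by move=> x x1; apply: dQ; exact: lt_le_trans x1.
- move=> x x1; have x0 : 0 < x by exact: lt_le_trans x1.
  rewrite mulr_ge0 ?(ltW (P_gt0 x x0))//.
  by rewrite !mulr_ge0 ?expR_ge0 ?invr_ge0 ?(ltW kappa0) ?(ltW x0).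
Qed.

Let M := Num.max kappa 1.
Let M1 : 1 <= M. Proof. by rewrite le_max lexx orbT. Qed.
Let Mk : kappa <= M. Proof. by rewrite le_max lexx. Qed.
Let M0 : 0 < M. Proof. exact: lt_le_trans M1. Qed.

(** The right side grows at least as fast as P: its derivative contains
   M (2 - 1/z) S Q, while P' = kappa S Q, and 2 - 1/z >= 1. *)
Let P_le_SQ z : 1 <= z -> P z <= M * S z * Q z.
Proof.
pose dQx t := kappa / t * expR (- (2 * t)) * P t.
move=> z1; rewrite -subr_ge0.
have : M * S 1 * Q 1 - P 1 <= M * S z * Q z - P z.
  apply: (@nondecreasing_is_derive _ 1 (fun t => M * S t * Q t - P t)
    (fun t => M * ((2 - t^-1) * S t) * Q t + M * S t * dQx t - kappa * S t * Q t)) => //.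
  - move=> x x1; have x0 : 0 < x by exact: lt_le_trans x1.
    apply: is_derive_sub; last exact: dP.
    apply: is_derive_mul; last exact: dQ.
    by apply: is_derive_scale; exact: dS.
  - move=> x x1; have x0 : 0 < x by exact: lt_le_trans x1.
    have Sx := S_gt0 x x0; have Qx := Q_gt0 x x0; have Px := P_gt0 x x0.
    have x1' : x^-1 <= 1 by rewrite invf_le1.
    have dq0 : 0 <= dQx x.
      rewrite mulr_ge0 ?(ltW Px)//.
      by rewrite !mulr_ge0 ?expR_ge0 ?invr_ge0 ?(ltW kappa0) ?(ltW x0).
    have h1 : 0 <= M * S x * dQx x by rewrite mulr_ge0 ?dq0// mulr_ge0 ?(ltW M0) ?(ltW Sx).
    have h2 : 0 <= (M * (2 - x^-1) - kappa) * (S x * Q x).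
      rewrite mulr_ge0//; last by rewrite mulr_ge0 ?(ltW Sx) ?(ltW Qx).
      rewrite subr_ge0 (le_trans Mk)// ler_peMr ?(ltW M0)//; lra.
    move: h1 h2; move: (M * S x * dQx x) => w h1 h2.
    rewrite [X in 0 <= X](_ : _ = (M * (2 - x^-1) - kappa) * (S x * Q x) + w) ?addr_ge0//.
    by ring.
apply: le_trans; rewrite /S /Q /P exp2E divr1 powR1 !mul1r expRN.
rewrite [X in 0 <= X](_ : _ = expR 1 * (M * bessel_plus 1 - bessel_minus 1)).
  rewrite mulr_ge0 ?expR_ge0// subr_ge0 (le_trans (minus_le_plus _ ler01))//.
  by rewrite ler_peMl// ltW// bessel_plus_gt0.
have e0 : expR 1 != 0 :> R by rewrite gt_eqF// expR_gt0.
move: (expR 1) e0 => e e0; by field.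
Qed.

(** By the preceding bound Q' <= (kappa M / z^2) Q, so that Q e^(kappa M / z)
   decreases. *)
Let Q_ub z : 1 <= z -> Q z <= Q 1 * expR (kappa * M).
Proof.
move=> z1.
pose W t := Q t * expR (kappa * M * t^-1).
pose dQx t := kappa / t * expR (- (2 * t)) * P t.
have WW : - W 1 <= - W z.
  apply: (@nondecreasing_is_derive _ 1 (fun t => - W t)
    (fun t => -1 * (dQx t * expR (kappa * M * t^-1) +
       Q t * (expR (kappa * M * t^-1) * (kappa * M * - t ^- 2))))) => //.
  - move=> x x1; have x0 : 0 < x by exact: lt_le_trans x1.
    under eq_fun do rewrite -mulN1r.
    apply: is_derive_scale; apply: is_derive_mul; first exact: dQ.
    apply: (is_derive_comp expR); apply: is_derive_scale.
    by apply: dinv; rewrite gt_eqF.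
  - move=> x x1; have x0 : 0 < x by exact: lt_le_trans x1.
    have := P_le_SQ x x1; rewrite -subr_ge0 => h.
    rewrite [X in 0 <= X](_ : _ = expR (kappa * M / x) * (kappa / x) *
       expR (- (2 * x)) * (M * S x * Q x - P x)).
      by rewrite mulr_ge0 ?h// !mulr_ge0 ?expR_ge0 ?invr_ge0 ?(ltW kappa0) ?(ltW x0).
    rewrite /dQx /S expRN.
    have e0 : expR (2 * x) != 0 by rewrite gt_eqF// expR_gt0.
    move: (expR (kappa * M / x)) (Q x) (P x) (expR (2 * x)) e0 => e q p s e0.
    by field; rewrite e0 gt_eqF.
have z0 : 0 < z by exact: lt_le_trans z1.
apply: (@le_trans _ _ (W z)).
  rewrite /W ler_peMr ?(ltW (Q_gt0 z z0))// -expR0 ler_expR.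
  by rewrite mulr_ge0 ?invr_ge0 ?(ltW z0)// mulr_ge0 ?(ltW kappa0) ?(ltW M0).
by move: WW; rewrite lerN2 {2}/W invr1 mulr1.
Qed.

(** Q being bounded below, P' exceeds a multiple of S, and S' <= 2 S. *)
Let P_lb : exists2 m : R, 0 < m & forall z, 1 <= z -> m * S z <= P z.
Proof.
have Q1 := Q_gt0 1 ltr01; have P1 := P_gt0 1 ltr01; have S1 := S_gt0 1 ltr01.
pose m := Num.min (kappa * Q 1 / 2) (P 1 / S 1).
have m0 : 0 < m by rewrite lt_min !divr_gt0// mulr_gt0.
exists m => // z z1; rewrite -subr_ge0.
have : P 1 - m * S 1 <= P z - m * S z.
  apply: (@nondecreasing_is_derive _ 1 (fun t => P t - m * S t)
    (fun t => kappa * S t * Q t - m * ((2 - t^-1) * S t))) => //.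
  - move=> x x1; have x0 : 0 < x by exact: lt_le_trans x1.
    apply: is_derive_sub; first exact: dP.
    by apply: is_derive_scale; exact: dS.
  - move=> x x1; have x0 : 0 < x by exact: lt_le_trans x1.
    have Sx := S_gt0 x x0; have Qx := Q_lb x x1.
    have x2 : 0 < x^-1 by rewrite invr_gt0.
    rewrite [X in 0 <= X](_ : _ = S x * (kappa * Q x - m * (2 - x^-1))); last by ring.
    rewrite mulr_ge0 ?(ltW Sx)// subr_ge0.
    apply: (@le_trans _ _ (m * 2)); first by rewrite ler_pM2l//; lra.
    rewrite -ler_pdivlMr//; apply: (@le_trans _ _ (kappa * Q 1 / 2)).
      by rewrite ge_min lexx.
    by rewrite ler_pdivrMr// divfK// ler_pM2l.
apply: le_trans; rewrite subr_ge0 -ler_pdivlMr//.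
by rewrite ge_min lexx orbT.
Qed.

(** Bounds on [1, oo) suffice: compactness provides them on [0, 1]. *)
Let extend_bounds (f : R -> R) (m N : R) :
  (forall z, {for z, continuous f}) -> (forall z, 0 <= z -> 0 < f z) ->
  0 < m -> (forall z, 1 <= z -> m <= f z <= N) ->
  exists c C : R, [/\ 0 < c, 0 < C & forall z, 0 <= z -> c <= f z <= C].
Proof.
move=> cf f0 m0 mN.
have cf01 : {within `[0, 1], continuous f}.
  by apply: continuous_in_subspaceT => x _; exact: cf.
have [a a01 ha] := @EVT_min R f 0 1 ler01 cf01.
have [b b01 hb] := @EVT_max R f 0 1 ler01 cf01.
have fa : 0 < f a by apply: f0; move: a01; rewrite in_itv/= => /andP[].
have fb : 0 < f b by apply: f0; move: b01; rewrite in_itv/= => /andP[].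
exists (Num.min m (f a)), (Num.max N (f b)); split.
- by rewrite lt_min m0.
- by rewrite lt_max fb orbT.
move=> z z0; rewrite ge_min le_max.
have [z1|z1] := leP 1 z; first by have /andP[-> ->] := mN z z1.
by rewrite ha ?hb ?orbT// in_itv/= z0 ltW.
Qed.

Let weight (a z : R) : 1 <= z -> 0 <= a -> z `^ a <= (1 + z) `^ a <= 2 `^ a * z `^ a.
Proof.
move=> z1 aa; have z0 : 0 <= z by exact: le_trans z1.
have h1 : 0 <= 1 + z by lra.
rewrite -powRM// !ge0_ler_powR ?nnegrE ?mulr_ge0//; lra.
Qed.

Let continuous_weight (a : R) (f : R -> R) z : {for z, continuous f} ->
  {for z, continuous (fun t => (1 + `|t|) `^ a * expR (- t) * f t)}.
Proof.
move=> cf; apply: cvgM => //; apply: cvgM.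
  have cn : {for z, continuous (fun t : R => 1 + `|t|)}.
    by apply: cvgD; [exact: cvg_cst|exact: norm_continuous].
  have cp : {for 1 + `|z|, continuous (fun t : R => t `^ a)}.
    by apply: continuous_powR; rewrite ltr_pwDl.
  exact: (continuous_comp cn cp).
apply: (@continuous_comp _ _ _ (-%R) expR); first exact: opp_continuous.
exact: continuous_expR.
Qed.

Let finish (a : R) (f : R -> R) (c C : R) : 0 < c -> 0 < C ->
  (forall z, 0 <= z -> c <= (1 + `|z|) `^ a * expR (- z) * f z <= C) ->
  forall z, 0 <= z ->
    c * ((1 + z) `^ (- a) * expR z) <= f z <= C * ((1 + z) `^ (- a) * expR z).
Proof.
move=> c0 C0 h z z0; have := h z z0; rewrite ger0_norm// powRN expRN.
have w0 : 0 < (1 + z) `^ a by rewrite powR_gt0; lra.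
have e0 := expR_gt0 z.
move: (_ `^ _) (expR z) w0 e0 => w e w0 e0.
have we : 0 < w / e by rewrite divr_gt0.
have -> : w^-1 * e = (w / e)^-1 by rewrite invf_div mulrC.
by rewrite ler_pdivrMr// ler_pdivlMr// [f z * _]mulrC.
Qed.

(** On [1, oo) the weighted function is Q up to a bounded factor. *)
Lemma bessel_plus_bounds : exists c C : R, [/\ 0 < c, 0 < C &
  forall z, 0 <= z ->
    c * ((1 + z) `^ (- kappa) * expR z) <= bessel_plus z <=
    C * ((1 + z) `^ (- kappa) * expR z)].
Proof.
pose f t := (1 + `|t|) `^ kappa * expR (- t) * bessel_plus t.
have [||||c [C [c0 C0 h]]] := @extend_bounds f (Q 1)
  (2 `^ kappa * (Q 1 * expR (kappa * M))).
- by move=> z; apply: continuous_weight; exact: continuous_bessel_plus.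
- move=> z z0; have w0 : 0 < 1 + `|z| by rewrite ltr_pwDl.
  by rewrite /f mulr_gt0 ?bessel_plus_gt0// mulr_gt0 ?powR_gt0 ?expR_gt0.
- exact: Q_gt0.
- move=> z z1; have z0 : 0 < z by exact: lt_le_trans z1.
  have /andP[w1 w2] := weight kappa z z1 (ltW kappa0).
  rewrite /f ger0_norm ?(ltW z0)//; apply/andP; split.
    apply: le_trans (Q_lb z z1) _; rewrite /Q -!mulrA ler_wpM2r//.
    by rewrite mulr_ge0 ?expR_ge0// ltW// bessel_plus_gt0// ltW.
  apply: (@le_trans _ _ (2 `^ kappa * Q z)); last by rewrite ler_pM2l ?powR_gt0// Q_ub.
  rewrite /Q -[leLHS]mulrA -[z `^ kappa * _ * _]mulrA [leRHS]mulrA ler_wpM2r//.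
  by rewrite mulr_ge0 ?expR_ge0// ltW// bessel_plus_gt0// ltW.
by exists c, C; split => //; exact: finish.
Qed.

(** On [1, oo) the weighted function is P/S up to a bounded factor; one power of
    z is lost against the sum, by cancellation. *)
Lemma bessel_minus_bounds : exists c C : R, [/\ 0 < c, 0 < C &
  forall z, 0 <= z ->
    c * ((1 + z) `^ (- (kappa + 1)) * expR z) <= bessel_minus z <=
    C * ((1 + z) `^ (- (kappa + 1)) * expR z)].
Proof.
have [m m0 hm] := P_lb.
have k1 : 0 <= kappa + 1 by rewrite addr_ge0// ltW.
pose f t := (1 + `|t|) `^ (kappa + 1) * expR (- t) * bessel_minus t.
have [||||c [C [c0 C0 h]]] := @extend_bounds f m
  (2 `^ (kappa + 1) * (M * (Q 1 * expR (kappa * M)))).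
- by move=> z; apply: continuous_weight; exact: continuous_bessel_minus.
- move=> z z0; have w0 : 0 < 1 + `|z| by rewrite ltr_pwDl.
  by rewrite /f mulr_gt0 ?bessel_minus_gt0// mulr_gt0 ?powR_gt0 ?expR_gt0.
- by [].
- move=> z z1; have z0 : 0 < z by exact: lt_le_trans z1.
  have /andP[w1 w2] := weight (kappa + 1) z z1 k1.
  have e0 : 0 <= expR (- z) * bessel_minus z.
    by rewrite mulr_ge0 ?expR_ge0// ltW// bessel_minus_gt0// ltW.
  have SP : z `^ (kappa + 1) * (expR (- z) * bessel_minus z) = P z / S z.
    rewrite powRD ?(gt_eqF z0) ?implybT// powRr1 ?(ltW z0)// /P /S exp2E expRN.
    have e1 : expR z != 0 by rewrite gt_eqF// expR_gt0.
    move: (expR z) (bessel_minus z) (z `^ kappa) e1 => e p w e1.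
    by field; rewrite e1 gt_eqF.
  rewrite /f ger0_norm ?(ltW z0)// -mulrA; apply/andP; split.
    apply: (@le_trans _ _ (P z / S z)); first by rewrite ler_pdivlMr ?S_gt0// hm.
    by rewrite -SP ler_wpM2r.
  apply: (@le_trans _ _ (2 `^ (kappa + 1) * (P z / S z))).
    by rewrite -SP [leRHS]mulrA ler_wpM2r.
  rewrite ler_pM2l ?powR_gt0// ler_pdivrMr ?S_gt0//.
  apply: le_trans (P_le_SQ z z1) _; rewrite mulrAC ler_pM2r ?S_gt0//.
  by rewrite ler_pM2l// Q_ub.
by exists c, C; split => //; exact: finish.
Qed.

End BesselGrowth.

(** * The heat kernel *)

Section HeatKernel.
Context {R : realType}.
Local Open Scope classical_set_scope.
Implicit Types (alpha t x y : R).

Let entire_kernel alpha t (p : R * R) : R :=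
  (2 * t)^-1 * (4 * t) `^ (- alpha) *
  (expR (- ((p.1 ^+ 2 + p.2 ^+ 2) / (4 * t))) *
   bessel_entire alpha ((p.1 * p.2 / (4 * t)) ^+ 2)).

Let heat_kernel_posE alpha t x y : - 1 < alpha -> 0 < t -> 0 < x -> 0 < y ->
  heat_kernel_pos alpha t x y = entire_kernel alpha t (x, y).
Proof.
move=> a1 t0 x0 y0; have xy0 : 0 < x * y by rewrite mulr_gt0.
have t2 : 0 < 2 * t by rewrite mulr_gt0.
rewrite /heat_kernel_pos besselIE ?divr_gt0// /entire_kernel/=.
have -> : x * y / (2 * t) / 2 = x * y / (4 * t) by field; rewrite gt_eqF.
have t4 : 0 <= 4 * t by rewrite mulr_ge0// ltW.
rewrite (powRM (x := x * y)) ?invr_ge0 ?(ltW xy0)//.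
rewrite -[(4 * t)^-1]powR_inv1// -powRrM mulN1r.
have n0 : (x * y) `^ alpha != 0 by rewrite gt_eqF// powR_gt0.
rewrite powRN; move: (_ `^ alpha) n0 => u n0.
by field; rewrite n0 gt_eqF.
Qed.

Let continuous_entire_kernel alpha t (p : R * R) : - 1 < alpha ->
  {for p, continuous (entire_kernel alpha t)}.
Proof.
move=> a1; have c1 : {for p, continuous (fun q : R * R => q.1)} by exact: cvg_fst.
have c2 : {for p, continuous (fun q : R * R => q.2)} by exact: cvg_snd.
apply: cvgM; first exact: cvg_cst.
apply: cvgM.
  have h : {for p, continuous (fun q : R * R => - ((q.1 ^+ 2 + q.2 ^+ 2) / (4 * t)))}.
    by apply: cvgN; apply: cvgM; [apply: cvgD; apply: cvgM|exact: cvg_cst].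
  by apply: (continuous_comp h); exact: continuous_expR.
have h : {for p, continuous (fun q : R * R => (q.1 * q.2 / (4 * t)) ^+ 2)}.
  by apply: cvgM; apply: cvgM; [apply: cvgM|exact: cvg_cst|apply: cvgM|exact: cvg_cst].
apply: (continuous_comp h).
exact: is_derive_continuous (is_derive_bessel _ _ a1).
Qed.

(** The power (xy)^(-alpha) cancels the one in I_alpha, so that the formula
    obtained for x, y > 0 is continuous on the whole plane and its values on
    the axes are the limits. *)
Lemma heat_kernelE alpha t x y : - 1 < alpha -> 0 < t -> 0 <= x -> 0 <= y ->
  heat_kernel alpha t x y =
  (2 * t)^-1 * (4 * t) `^ (- alpha) *
  (expR (- ((x ^+ 2 + y ^+ 2) / (4 * t))) *
   bessel_entire alpha ((x * y / (4 * t)) ^+ 2)).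
Proof.
move=> a1 t0 x0 y0; rewrite -[RHS]/(entire_kernel alpha t (x, y)) /heat_kernel.
case: ifP => [/andP[x1 y1]|_]; first exact: heat_kernel_posE.
have PF : ProperFilter (within [set q : R * R | 0 < q.1 /\ 0 < q.2] (nbhs (x, y))).
  apply: within_nbhs_proper => B [[B1 B2] /= [hB1 hB2] hB].
  have [e1 /= e10 h1] := hB1; have [e2 /= e20 h2] := hB2.
  pose e := Num.min e1 e2 / 2.
  have e0 : 0 < e by rewrite divr_gt0// lt_min e10.
  have me : e < Num.min e1 e2 by rewrite ltr_pdivrMr// ltr_pMr ?ltr1n// lt_min e10.
  move: me; rewrite lt_min => /andP[ee1 ee2].
  exists (x + e, y + e); split => /=; first by rewrite !ltr_wpDl.
  apply: hB; split => /=.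
    by apply: h1; rewrite /ball_/= opprD addrA subrr sub0r normrN gtr0_norm.
  by apply: h2; rewrite /ball_/= opprD addrA subrr sub0r normrN gtr0_norm.
apply: cvg_lim => //.
apply: (@cvg_trans _ (entire_kernel alpha t q @[q -->
    within [set q : R * R | 0 < q.1 /\ 0 < q.2] (nbhs (x, y))])).
  apply: near_eq_cvg; near=> q.
  have [q1 q2] : 0 < q.1 /\ 0 < q.2 by near: q; exact: withinT.
  by rewrite heat_kernel_posE//; case: q {q1 q2}.
apply: (cvg_trans _ (continuous_entire_kernel alpha t (x, y) a1)).
by apply: cvg_app; exact: cvg_within.
Unshelve. all: by end_near. Qed.

(** With z = |xy|/2t one has xy/4t = z/2 up to the sign of xy: the second kernel
    contributes the odd part with that sign. *)
Lemma dunkl_heat_kernelE alpha t x y : - 1 < alpha -> 0 < t ->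
  dunkl_heat_kernel alpha t x y =
  2^-1 * (2 * t)^-1 * (4 * t) `^ (- alpha) *
  expR (- ((`|x| ^+ 2 + `|y| ^+ 2) / (4 * t))) *
  (if 0 <= x * y then bessel_plus alpha (`|x| * `|y| / (2 * t))
   else bessel_minus alpha (`|x| * `|y| / (2 * t))).
Proof.
move=> a1 t0; have a2 : - 1 < alpha + 1 by lra.
have tn : t != 0 by rewrite gt_eqF.
rewrite /dunkl_heat_kernel !heat_kernelE//.
have t4 : 0 < 4 * t by rewrite mulr_gt0.
have -> : (4 * t) `^ (- (alpha + 1)) = (4 * t) `^ (- alpha) / (4 * t).
  by rewrite opprD powRD ?(gt_eqF t4) ?implybT// powR_inv1// ltW.
rewrite /bessel_plus /bessel_minus /bessel_even /bessel_odd.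
have -> : `|x| * `|y| / (2 * t) / 2 = `|x| * `|y| / (4 * t) by field.
move: (bessel_entire _ _) (bessel_entire _ _) ((4 * t) `^ _) (expR _) => f g u e.
rewrite -normrM; case: ifPn => xy.
  by rewrite ger0_norm//; field.
by rewrite ltr0_norm ?ltNge//; field.
Qed.

(** Here d stands for ||x| - |y|| and m for |xy|. The growth exp(m/2t) turns the
    Gaussian factor into exp(-d^2/4t); replacing 2t + m by t + d^2 + 4m costs at
    most a power of 1 + d^2/t, which half of the Gaussian absorbs. *)
Lemma growth_kernel_bounds alpha (A : R) (f : R -> R) : 0 < A ->
  (exists c C : R, [/\ 0 < c, 0 < C & forall z, 0 <= z ->
    c * ((1 + z) `^ (- A) * expR z) <= f z <= C * ((1 + z) `^ (- A) * expR z)]) ->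
  exists c C : R, [/\ 0 < c, 0 < C & forall t d m, 0 < t -> 0 <= d -> 0 <= m ->
    c * (t `^ (A - alpha - 1) * (t + (d ^+ 2 + 4 * m)) `^ (- A) *
         expR (- (4^-1 * d ^+ 2 / t))) <=
    2^-1 * (2 * t)^-1 * (4 * t) `^ (- alpha) *
      expR (- ((d ^+ 2 + 2 * m) / (4 * t))) * f (m / (2 * t)) <=
    C * (t `^ (A - alpha - 1) * (t + (d ^+ 2 + 4 * m)) `^ (- A) *
         expR (- (8^-1 * d ^+ 2 / t)))].
Proof.
move=> A0 [c [C [c0 C0 hf]]].
have [D D0 hD] := @powR_le_expR R A 8^-1 (ltW A0) (ltac:(by rewrite invr_gt0)).
have [K [K0 KE]] : exists K : R,
    0 < K /\ K = 2^-1 * 2^-1 * 4 `^ (- alpha) * 2 `^ A.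
  by eexists; split; last reflexivity; rewrite !mulr_gt0 ?powR_gt0 ?invr_gt0.
exists (c * K * 2 `^ (- A)), (C * K * (4 `^ A * (D * expR 8^-1))).
split; try by rewrite !mulr_gt0 ?powR_gt0 ?expR_gt0.
move=> t d m t0 d0 m0.
have tn : t != 0 by rewrite gt_eqF.
have t2 : 0 < 2 * t by rewrite mulr_gt0.
have t2m : 0 < 2 * t + m by rewrite ltr_wpDr.
have ts : 0 < t + (d ^+ 2 + 4 * m).
  by rewrite ltr_wpDr// addr_ge0 ?sqr_ge0// mulr_ge0.
have pre g : 2^-1 * (2 * t)^-1 * (4 * t) `^ (- alpha) *
      expR (- ((d ^+ 2 + 2 * m) / (4 * t))) *
      (g * ((1 + m / (2 * t)) `^ (- A) * expR (m / (2 * t)))) =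
    g * K * (t `^ (A - alpha - 1) * (2 * t + m) `^ (- A) *
      expR (- (4^-1 * d ^+ 2 / t))).
  have -> : 1 + m / (2 * t) = (2 * t + m) / (2 * t) by field.
  rewrite (powRM (x := 2 * t + m)) ?invr_ge0 ?(ltW t2) ?(ltW t2m)//.
  have -> : (2 * t)^-1 `^ (- A) = (2 * t) `^ A.
    by rewrite -powR_inv1 ?(ltW t2)// -powRrM mulN1r opprK.
  rewrite !powRM ?(ltW t0)//.
  have -> : t `^ (A - alpha - 1) = t `^ A * t `^ (- alpha) / t.
    by rewrite !powRD ?tn ?implybT// powR_inv1 ?(ltW t0).
  have -> : expR (- (4^-1 * d ^+ 2 / t)) =
      expR (- ((d ^+ 2 + 2 * m) / (4 * t))) * expR (m / (2 * t)).
    by rewrite -expRD; congr expR; field.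
  rewrite KE.
  move: (expR _) (expR _) (t `^ _) (t `^ _) (4 `^ _) (2 `^ _) (_ `^ (- A)) => *.
  by field.
have [u [u0 tu]] : exists u, 0 <= u /\ t * u = d ^+ 2.
  exists (d ^+ 2 / t); split; last by field.
  by rewrite divr_ge0 ?sqr_ge0// ltW.
have -> : 8^-1 * d ^+ 2 / t = 8^-1 * u by rewrite -tu; field.
have e4 : 4^-1 * d ^+ 2 / t = 4^-1 * u by rewrite -tu; field.
rewrite e4 in pre *.
have z0 : 0 <= m / (2 * t) by rewrite divr_ge0// ltW.
have /andP[f1 f2] := hf _ z0.
set E := 2^-1 * (2 * t)^-1 * (4 * t) `^ (- alpha) * expR (- ((d ^+ 2 + 2 * m) / (4 * t))).
have E0 : 0 < E by rewrite /E !mulr_gt0 ?powR_gt0 ?expR_gt0 ?invr_gt0 ?mulr_gt0.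
have T0 : 0 < t `^ (A - alpha - 1) by rewrite powR_gt0.
apply/andP; split.
  apply: (@le_trans _ _ (E * (c * ((1 + m / (2 * t)) `^ (- A) * expR (m / (2 * t)))))); last first.
    by rewrite ler_pM2l.
  rewrite pre -!mulrA ler_pM2l// ler_pM2l//.
  rewrite [leLHS]mulrCA ler_pM2l// mulrA ler_pM2r ?expR_gt0//.
  rewrite -powRM ?(ltW ts)// !powRN lef_pV2 ?posrE ?powR_gt0 ?mulr_gt0//.
  rewrite ge0_ler_powR ?nnegrE ?(ltW A0) ?(ltW t2m) ?mulr_ge0 ?(ltW ts)//.
  have := sqr_ge0 d; lra.
apply: (@le_trans _ _ (E * (C * ((1 + m / (2 * t)) `^ (- A) * expR (m / (2 * t)))))).
  by rewrite ler_pM2l.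
rewrite pre -!mulrA ler_pM2l// ler_pM2l//.
rewrite [leRHS](_ : _ = t `^ (A - alpha - 1) * ((4 `^ A * ((t + (d ^+ 2 + 4 * m)) `^ (- A))) *
   (D * (expR 8^-1 * expR (- (8^-1 * u)))))); last by ring.
rewrite ler_pM2l//.
have -> : expR (- (4^-1 * u)) = expR (- (8^-1 * u)) * expR (- (8^-1 * u)).
  by rewrite -expRD; congr expR; field.
rewrite [leLHS]mulrA [D * _]mulrA [leRHS]mulrA ler_pM2r ?expR_gt0//.
rewrite expRN ler_pdivrMr ?expR_gt0// -!mulrA -expRD.
have -> : 8^-1 + 8^-1 * u = 8^-1 * (1 + u) by ring.
have hu : (1 + u) `^ A <= D * expR (8^-1 * (1 + u)) by apply: hD; rewrite addr_ge0.
apply: (@le_trans _ _ (4 `^ A * ((t + (d ^+ 2 + 4 * m)) `^ (- A) * (1 + u) `^ A))); last first.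
  by rewrite !ler_pM2l ?powR_gt0.
rewrite !powRN mulrCA [leRHS]mulrC ler_pdivlMr ?powR_gt0// mulrC.
rewrite ler_pdivrMr ?powR_gt0//.
have u1 : 0 <= 1 + u by rewrite addr_ge0.
rewrite -!powRM ?(ltW t2m) ?u1 ?mulr_ge0//.
rewrite ge0_ler_powR ?nnegrE ?(ltW A0) ?(ltW ts) ?mulr_ge0 ?(ltW t2m) ?addr_ge0//.
have mu : 0 <= m * u by rewrite mulr_ge0.
have := sqr_ge0 d; rewrite -tu; lra.
Qed.

End HeatKernel.

(** * The potential integral, and its size for small s *)

Section PotentialIntegral.
Context {R : realType}.
Local Open Scope classical_set_scope.
Notation mu := (@lebesgue_measure R).
Implicit Types (tau A c s d t : R).

(** The integrand left by the Gaussian estimates: s stands for |x| + |y| and d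
    for the distance of |x| and |y|. *)
Definition pot tau A c s d t : R :=
  expR (- t) * (t `^ (tau - 1) * (t + s ^+ 2) `^ (- A) *
                expR (- (c * d ^+ 2 / t))).

Definition potential tau A c s d : \bar R :=
  (\int[mu]_(t in `]0%R, +oo[) (pot tau A c s d t)%:E)%E.

Lemma pot_ge0 tau A c s d t : 0 < t -> 0 <= pot tau A c s d t.
Proof. by move=> _; rewrite /pot !mulr_ge0 ?expR_ge0 ?powR_ge0. Qed.

Lemma posmeasurable_pot tau A c s d : posmeasurable (pot tau A c s d).
Proof.
apply: posmeasurableM.
  by have := @posmeasurable_expN R 1; under eq_fun do rewrite mul1r.
apply: posmeasurableM; last exact: posmeasurable_expV.
apply: posmeasurableM; first exact: posmeasurable_powR.
apply: continuous_posmeasurable => x x0.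
have h : {for x, continuous (fun t : R => t + s ^+ 2)}.
  by apply: cvgD; [exact: cvg_id|exact: cvg_cst].
have g : {for x + s ^+ 2, continuous (fun t : R => t `^ (- A))}.
  by apply: continuous_powR; rewrite ltr_wpDr// sqr_ge0.
exact: (continuous_comp h g).
Qed.

Lemma posmeasurable_powR_expV p c : posmeasurable (fun t : R => t `^ p * expR (- (c / t))).
Proof. by apply: posmeasurableM; [exact: posmeasurable_powR|exact: posmeasurable_expV]. Qed.

Lemma posmeasurable_expN_powR p c : posmeasurable (fun t : R => expR (- (c * t)) * t `^ p).
Proof. by apply: posmeasurableM; [exact: posmeasurable_expN|exact: posmeasurable_powR]. Qed.

Lemma posmeasurable_scale (k : R) (f : R -> R) :
  posmeasurable f -> posmeasurable (fun t => k * f t).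
Proof. by move=> mf; apply: posmeasurableM; [exact: posmeasurable_cst|]. Qed.

Lemma le_powRN A (x y : R) : 0 <= A -> 0 < x -> x <= y -> y `^ (- A) <= x `^ (- A).
Proof.
move=> A0 x0 xy; have y0 : 0 < y by exact: lt_le_trans xy.
rewrite !powRN lef_pV2 ?posrE ?powR_gt0//.
by rewrite ge0_ler_powR// ?nnegrE ltW.
Qed.

Lemma potential_antitone tau A c s d s' d' : 0 < A -> 0 < c ->
  0 <= s <= s' -> 0 <= d <= d' ->
  (potential tau A c s' d' <= potential tau A c s d)%E.
Proof.
move=> A0 c0 /andP[s0 ss] /andP[d0 dd]; apply: le_integral_pos => //.
- exact: posmeasurable_pot.
- exact: posmeasurable_pot.
move=> t; rewrite /= in_itv/= andbT => t0; rewrite pot_ge0//= /pot.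
rewrite ler_pM2l ?expR_gt0//; apply: ler_pM; rewrite ?expR_ge0 ?mulr_ge0 ?powR_ge0//.
  rewrite ler_pM2l ?powR_gt0//; apply: le_powRN; rewrite ?(ltW A0)//.
    by rewrite ltr_wpDr// sqr_ge0.
  by rewrite lerD2l ler_sqr ?nnegrE// (le_trans s0).
rewrite ler_expR lerN2 ler_pM2r ?invr_gt0// ler_pM2l//.
by rewrite ler_sqr ?nnegrE// (le_trans d0).
Qed.

Lemma potential_ge0 tau A c s d : (0 <= potential tau A c s d)%E.
Proof.
apply: integral_ge0 => t; rewrite /= in_itv/= andbT => t0.
by rewrite lee_fin pot_ge0.
Qed.

Lemma potential_part_le tau A c s d (i : interval R) (f : R -> R) (k N : R) :
  [set` i] `<=` (`]0, +oo[ : set R) ->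
  posmeasurable f -> (forall t, 0 < t -> 0 <= f t) -> 0 <= k ->
  (forall t, t \in i -> pot tau A c s d t <= k * f t) ->
  (\int[mu]_(t in [set` i]) (f t)%:E <= N%:E)%E ->
  (\int[mu]_(t in [set` i]) (pot tau A c s d t)%:E <= (k * N)%:E)%E.
Proof.
move=> sub mf f0 k0 hp hN.
apply: (@le_trans _ _ (\int[mu]_(t in [set` i]) (k * f t)%:E)%E).
  apply: le_integral_pos => //; first exact: posmeasurable_pot.
    exact: posmeasurable_scale.
  move=> t ti; rewrite hp//= andbT pot_ge0//.
  by have := sub _ ti; rewrite /= in_itv/= andbT.
by rewrite integral_posZ// EFinM; apply: lee_wpmul2l; rewrite ?lee_fin.
Qed.

Lemma le_potential_part tau A c s d (i : interval R) (f : R -> R) (k N : R) :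
  [set` i] `<=` (`]0, +oo[ : set R) ->
  posmeasurable f -> (forall t, 0 < t -> 0 <= f t) -> 0 <= k ->
  (forall t, t \in i -> k * f t <= pot tau A c s d t) ->
  (N%:E <= \int[mu]_(t in [set` i]) (f t)%:E)%E ->
  ((k * N)%:E <= potential tau A c s d)%E.
Proof.
move=> sub mf f0 k0 hp hN.
apply: (@le_trans _ _ (\int[mu]_(t in [set` i]) (pot tau A c s d t)%:E)%E); last first.
  apply: le_integral_sub => //; first exact: posmeasurable_pot.
  exact: pot_ge0.
apply: (@le_trans _ _ (\int[mu]_(t in [set` i]) (k * f t)%:E)%E).
  by rewrite integral_posZ// EFinM; apply: lee_wpmul2l; rewrite ?lee_fin.
apply: le_integral_pos => //; last 2 first.
- exact: posmeasurable_pot.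
- move=> t ti; rewrite hp//= andbT mulr_ge0//; apply: f0.
  by have := sub _ ti; rewrite /= in_itv/= andbT.
exact: posmeasurable_scale.
Qed.

Lemma powsize_ge1 (p a : R) : 0 <= a <= 1 -> (0 < a) || (0 < p) -> 1 <= powsize p a 1.
Proof.
move=> /andP[a0 a1]; rewrite /powsize; case: ifP => [_ _|/negbT].
  by rewrite powR1.
rewrite -leNgt => p0; rewrite orbF => {}a0.
case: ifP => [_|pn]; first by rewrite lerDl ln_ge0// ler_pdivlMr// mul1r.
rewrite -[leLHS](powRr0 a); apply: ger_powR => //.
by rewrite a0.
Qed.

(** Where a = 0 there is no cut-off left, and the power has to be integrable
    at 0. *)
Lemma integral_cutoff_le (p c : R) : 0 < c -> exists2 C : R, 0 < C &
  forall a b : R, 0 <= a <= b -> 0 < b -> (0 < a) || (0 < p) ->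
  (\int[mu]_(t in `]0%R, b]) (t `^ (p - 1) * expR (- (c * a / t)))%:E <=
     (C * powsize p a b)%:E)%E.
Proof.
move=> c0; have [C C0 hC] := integral_powR_exp_le p c c0.
have [p0|p0] := ltP 0 p; last first.
  by exists C => // a b /andP[_ ab] _; rewrite orbF => a0; apply: hC; rewrite a0.
exists p^-1; first by rewrite invr_gt0.
move=> a b /andP[a0 ab] b0 _; rewrite /powsize p0.
apply: le_trans (integral_powR_0_le p b p0 b0).
apply: le_integral_pos => //.
- by apply: sub_pos_itv; rewrite /= bnd_simp.
- exact: posmeasurable_powR_expV.
- exact: posmeasurable_powR.
move=> t /=; rewrite in_itv/= => /andP[t0 _].
rewrite mulr_ge0 ?expR_ge0 ?powR_ge0//= ler_piMr ?powR_ge0// -expR0 ler_expR.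
by rewrite oppr_le0 divr_ge0 ?mulr_ge0// ltW.
Qed.

(** Up to s^2 the factor (t + s^2)^(-A) is replaced by s^(-2A), on [s^2, 1] by
    t^(-A); past 1 the integral is bounded. *)
Lemma potential_small_le tau A c : 0 < A -> 0 < c ->
  exists2 C : R, 0 < C & forall s d, 0 < s <= 1 -> 0 <= d <= s ->
  (0 < d) || (0 < tau) ->
  (potential tau A c s d <= (C * (powsize (tau - A) (s ^+ 2) 1 +
     (s ^+ 2) `^ (- A) * powsize tau (d ^+ 2) (s ^+ 2)))%:E)%E.
Proof.
move=> A0 c0.
have [C1 C10 h1] := integral_cutoff_le tau c c0.
have [C2 C20 h2] := @integral_powR_le R (tau - A).
have [C3 C30 h3] := @integral_expR_tail_le R (tau - 1) 1 ltr01.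
exists (C1 + C2 + C3); first by rewrite !addr_gt0.
move=> s d /andP[s0 s1] /andP[d0 ds] dt.
have ss0 : 0 < s ^+ 2 by rewrite exprn_gt0.
have ss1 : s ^+ 2 <= 1 by rewrite exprn_ile1// ltW.
have dd0 : 0 <= d ^+ 2 by rewrite sqr_ge0.
have dds : d ^+ 2 <= s ^+ 2 by rewrite ler_sqr ?nnegrE// ltW.
have dt' : (0 < d ^+ 2) || (0 < tau).
  by case/orP: dt => [h|->]; [rewrite exprn_gt0|rewrite orbT].
have w0 : 0 < (s ^+ 2) `^ (- A) by rewrite powR_gt0.
have ps1 : 1 <= powsize (tau - A) (s ^+ 2) 1.
  by apply: powsize_ge1; rewrite ?ss0// ltW.
have ps2 : 0 <= powsize tau (d ^+ 2) (s ^+ 2).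
  rewrite /powsize; case: ifP => [_|/negbT]; first exact: powR_ge0.
  rewrite -leNgt => t0; case: ifP => _; last exact: powR_ge0.
  move: dt'; rewrite [0 < tau]ltNge t0 orbF => dd.
  by rewrite addr_ge0// ln_ge0// ler_pdivlMr// mul1r.
have low : (\int[mu]_(t in `]0%R, (s ^+ 2)%R]) (pot tau A c s d t)%:E <=
    ((s ^+ 2) `^ (- A) * (C1 * powsize tau (d ^+ 2) (s ^+ 2)))%:E)%E.
  apply: (potential_part_le _ _ _ _ _ _
    (fun t => t `^ (tau - 1) * expR (- (c * d ^+ 2 / t)))).
  - by apply: sub_pos_itv; rewrite /= bnd_simp.
  - exact: posmeasurable_powR_expV.
  - by move=> t _; rewrite mulr_ge0 ?expR_ge0 ?powR_ge0.
  - exact: ltW.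
  - move=> t; rewrite in_itv/= => /andP[t0 _]; rewrite /pot.
    rewrite [leLHS](_ : _ = (t + s ^+ 2) `^ (- A) * (expR (- t) * t `^ (tau - 1)) *
      expR (- (c * d ^+ 2 / t))); last by ring.
    rewrite [leRHS]mulrA ler_pM2r ?expR_gt0//.
    rewrite ler_pM ?powR_ge0 ?mulr_ge0 ?expR_ge0 ?powR_ge0//.
      by apply: le_powRN; rewrite ?(ltW A0)// lerDr ltW.
    by rewrite ler_piMl ?powR_ge0// -expR0 ler_expR oppr_le0 ltW.
  - by apply: h1; rewrite ?dd0.
have mid : (\int[mu]_(t in `[(s ^+ 2)%R, 1%R]) (pot tau A c s d t)%:E <=
    (1 * (C2 * powsize (tau - A) (s ^+ 2) 1))%:E)%E.
  apply: (potential_part_le _ _ _ _ _ _ (fun t => t `^ (tau - A - 1))).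
  - by apply: sub_pos_itv; rewrite /= bnd_simp.
  - exact: posmeasurable_powR.
  - by move=> t _; exact: powR_ge0.
  - exact: ler01.
  - move=> t; rewrite in_itv/= => /andP[st _].
    have t0 : 0 < t by exact: lt_le_trans st.
    rewrite /pot mul1r.
    have -> : t `^ (tau - A - 1) = t `^ (tau - 1) * t `^ (- A).
      by rewrite -powRD ?(gt_eqF t0) ?implybT//; congr (_ `^ _); ring.
    rewrite -[leRHS]mul1r ler_pM ?expR_ge0 ?mulr_ge0 ?powR_ge0//.
      by rewrite -expR0 ler_expR oppr_le0 ltW.
    rewrite -[leRHS]mulr1 ler_pM ?expR_ge0 ?mulr_ge0 ?powR_ge0//.
      by rewrite ler_pM2l ?powR_gt0//; apply: le_powRN; rewrite ?(ltW A0)// lerDl ltW.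
    by rewrite -expR0 ler_expR oppr_le0 divr_ge0 ?mulr_ge0// ltW.
  - by apply: h2; rewrite ss0.
have hi : (\int[mu]_(t in `[1%R, +oo[) (pot tau A c s d t)%:E <= (1 * C3)%:E)%E.
  apply: (potential_part_le _ _ _ _ _ _ (fun t => expR (- (1 * t)) * t `^ (tau - 1))).
  - by apply: sub_pos_itv; rewrite /= bnd_simp.
  - exact: posmeasurable_expN_powR.
  - by move=> t _; rewrite mulr_ge0 ?expR_ge0 ?powR_ge0.
  - exact: ler01.
  - move=> t; rewrite in_itv/= andbT => t1.
    have t0 : 0 < t by exact: lt_le_trans t1.
    rewrite /pot !mul1r ler_pM2l ?expR_gt0//.
    rewrite -mulrA ler_piMr ?powR_ge0// -[leRHS]mulr1 ler_pM ?expR_ge0 ?powR_ge0//.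
      have <- : 1 `^ (- A) = 1 :> R by rewrite powR1.
      apply: le_powRN; rewrite ?(ltW A0)//.
      by rewrite (le_trans t1)// lerDl ltW.
    by rewrite -expR0 ler_expR oppr_le0 divr_ge0 ?mulr_ge0// ltW.
  - exact: h3.
have mp := posmeasurable_pot tau A c s d.
have pp := pot_ge0 tau A c s d.
rewrite /potential (integral_pos_split _ 1 ltr01 mp pp).
have s01 : 0 < s ^+ 2 <= 1 by rewrite ss0.
rewrite (integral_oc_split _ (s ^+ 2) 1 s01 mp pp).
apply: (le_trans (leeD (leeD low mid) hi)).
rewrite -!EFinD lee_fin !mul1r.
move: ps1 ps2 w0; move: (powsize _ _ _) (powsize _ _ _) (_ `^ _) => y x w x1 y0 w0.
have wy : 0 <= w * y by rewrite mulr_ge0// ltW.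
rewrite [w * (C1 * y)]mulrCA.
apply: (@le_trans _ _ (C1 * (x + w * y) + C2 * (x + w * y) + C3 * (x + w * y))); last by rewrite -!mulrDl.
apply: lerD; first apply: lerD.
- by rewrite ler_pM2l// lerDr (le_trans _ x1).
- by rewrite ler_pM2l// lerDl.
- by rewrite ler_pMr// (le_trans x1)// lerDl.
Qed.

(** For tau > A the power t^(tau-A-1) is integrable at 0, whence a bound that
    remains valid at the origin. *)
Lemma potential_bounded tau A c : 0 < A -> 0 < c -> A < tau ->
  exists2 C : R, 0 < C & forall s d, (potential tau A c s d <= C%:E)%E.
Proof.
move=> A0 c0 tA; have g0 : 0 < tau - A by rewrite subr_gt0.
exists (1 * Gamma (tau - A)); first by rewrite mul1r Gamma_gt0.
move=> s d.
apply: (potential_part_le _ _ _ _ _ _ (fun t => expR (- t) * t `^ (tau - A - 1))).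
- by [].
- by have := posmeasurable_expN_powR (tau - A - 1) 1; under eq_fun do rewrite mul1r.
- by move=> t _; rewrite mulr_ge0 ?expR_ge0 ?powR_ge0.
- exact: ler01.
- move=> t; rewrite in_itv/= andbT => t0.
  rewrite mul1r /pot ler_pM2l ?expR_gt0//.
  have -> : t `^ (tau - A - 1) = t `^ (tau - 1) * t `^ (- A).
    by rewrite -powRD ?(gt_eqF t0) ?implybT//; congr (_ `^ _); ring.
  rewrite -[leRHS]mulr1 ler_pM ?expR_ge0 ?mulr_ge0 ?powR_ge0//.
    by rewrite ler_pM2l ?powR_gt0//; apply: le_powRN; rewrite ?(ltW A0)// lerDl sqr_ge0.
  by rewrite -expR0 ler_expR oppr_le0 divr_ge0 ?(ltW t0)// mulr_ge0 ?sqr_ge0 ?(ltW c0).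
- by rewrite GammaE.
Qed.

(** The two terms come from [s^2, 2] and from [d^2, 2 s^2]; on both intervals the
    exponentials are bounded below. *)
Lemma le_potential_small tau A c : 0 < A -> 0 < c ->
  exists2 C : R, 0 < C & forall s d, 0 < s <= 1 -> 0 < d <= s ->
  ((C * (powsize (tau - A) (s ^+ 2) 1 +
     (s ^+ 2) `^ (- A) * powsize tau (d ^+ 2) (s ^+ 2)))%:E <=
   potential tau A c s d)%E.
Proof.
move=> A0 c0.
have [C1 C10 h1] := @le_integral_powR R (tau - A).
have [C2 C20 h2] := @le_integral_powR R tau.
pose k1 := expR (- 2) * (2 `^ (- A) * expR (- c)) : R.
pose k2 := expR (- 2) * (3 `^ (- A) * expR (- c)) : R.
have k10 : 0 < k1 by rewrite /k1 !mulr_gt0 ?expR_gt0 ?powR_gt0.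
have k20 : 0 < k2 by rewrite /k2 !mulr_gt0 ?expR_gt0 ?powR_gt0.
exists (Num.min (k1 * C1) (k2 * C2) / 2).
  by rewrite divr_gt0// lt_min (mulr_gt0 k10 C10) (mulr_gt0 k20 C20).
move=> s d /andP[s0 s1] /andP[d0 ds].
have ss0 : 0 < s ^+ 2 by rewrite exprn_gt0.
have ss1 : s ^+ 2 <= 1 by rewrite exprn_ile1// ltW.
have dd0 : 0 < d ^+ 2 by rewrite exprn_gt0.
have dds : d ^+ 2 <= s ^+ 2 by rewrite ler_sqr ?nnegrE// ltW.
have w0 : 0 < (s ^+ 2) `^ (- A) by rewrite powR_gt0.
have expc t : 0 < t -> d ^+ 2 <= t -> expR (- c) <= expR (- (c * d ^+ 2 / t)).
  by move=> t0 dt; rewrite ler_expR lerN2 ler_pdivrMr// ler_pM2l.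
have l1 : ((k1 * (C1 * powsize (tau - A) (s ^+ 2) 1))%:E <= potential tau A c s d)%E.
  apply: (le_potential_part _ _ _ _ _ `[(s ^+ 2), (2 * 1)]%R
    (fun t => t `^ (tau - A - 1))).
  - by apply: sub_pos_itv; rewrite /= bnd_simp.
  - exact: posmeasurable_powR.
  - by move=> t _; exact: powR_ge0.
  - exact: ltW.
  - move=> t; rewrite in_itv/= mulr1 => /andP[st t2].
    have t0 : 0 < t by exact: lt_le_trans st.
    rewrite /pot /k1 -[leLHS]mulrA -[t `^ _ * _ * expR _]mulrA ler_pM ?expR_ge0 ?mulr_ge0 ?powR_ge0//.
      by rewrite ler_expR lerN2.
    have -> : t `^ (tau - A - 1) = t `^ (tau - 1) * t `^ (- A).
      by rewrite -powRD ?(gt_eqF t0) ?implybT//; congr (_ `^ _); ring.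
    rewrite [leLHS](_ : _ = t `^ (tau - 1) * ((2 `^ (- A) * t `^ (- A)) * expR (- c))); last by ring.
    rewrite ler_pM2l ?powR_gt0//.
    have hA : 2 `^ (- A) * t `^ (- A) <= (t + s ^+ 2) `^ (- A).
      rewrite -powRM ?(ltW t0)//; apply: le_powRN; rewrite ?(ltW A0) ?addr_gt0//.
      by rewrite mulr_natl mulr2n lerD2l.
    have hc := expc t t0 (le_trans dds st).
    apply: ler_pM; rewrite ?expR_ge0 ?mulr_ge0 ?powR_ge0//.
  - by apply: h1; rewrite ss0.
have l2 : ((k2 * (s ^+ 2) `^ (- A) * (C2 * powsize tau (d ^+ 2) (s ^+ 2)))%:E <=
    potential tau A c s d)%E.
  apply: (le_potential_part _ _ _ _ _ `[(d ^+ 2), (2 * s ^+ 2)]%R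
    (fun t => t `^ (tau - 1))).
  - by apply: sub_pos_itv; rewrite /= bnd_simp.
  - exact: posmeasurable_powR.
  - by move=> t _; exact: powR_ge0.
  - by rewrite mulr_ge0 ?(ltW k20) ?(ltW w0).
  - move=> t; rewrite in_itv/= => /andP[dt ts].
    have t0 : 0 < t by exact: lt_le_trans dt.
    rewrite /pot /k2 -2![leLHS]mulrA -[t `^ _ * _ * expR _]mulrA ler_pM ?expR_ge0 ?mulr_ge0 ?powR_ge0//.
      rewrite ler_expR lerN2 (le_trans ts)//.
      by rewrite -[leRHS]mulr1 ler_pM2l.
    rewrite [leLHS](_ : _ = t `^ (tau - 1) * ((3 `^ (- A) * (s ^+ 2) `^ (- A)) * expR (- c))); last by ring.
    rewrite ler_pM2l ?powR_gt0//.
    have hA : 3 `^ (- A) * (s ^+ 2) `^ (- A) <= (t + s ^+ 2) `^ (- A).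
      rewrite -powRM ?(ltW ss0)//; apply: le_powRN; rewrite ?(ltW A0) ?addr_gt0//.
      by move: ts; lra.
    have hc := expc t t0 dt.
    apply: ler_pM; rewrite ?expR_ge0 ?mulr_ge0 ?powR_ge0//.
  - by apply: h2; rewrite dd0.
rewrite [(_ * _)%R in leLHS](_ : _ =
  2^-1 * (Num.min (k1 * C1) (k2 * C2) * powsize (tau - A) (s ^+ 2) 1) +
  2^-1 * (Num.min (k1 * C1) (k2 * C2) *
    ((s ^+ 2) `^ (- A) * powsize tau (d ^+ 2) (s ^+ 2)))); last by field.
have ps1 : 0 < powsize (tau - A) (s ^+ 2) 1 by apply: powsize_gt0; rewrite ss0.
have ps2 : 0 < powsize tau (d ^+ 2) (s ^+ 2) by apply: powsize_gt0; rewrite dd0.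
have m1 : Num.min (k1 * C1) (k2 * C2) <= k1 * C1 by rewrite ge_min lexx.
have m2 : Num.min (k1 * C1) (k2 * C2) <= k2 * C2 by rewrite ge_min lexx orbT.
move: l1 l2 (potential_ge0 tau A c s d).
case: (potential _ _ _ _ _) => [r|_ _ _|//]; last exact: leey.
rewrite !lee_fin => l1 l2 _.
apply: (@le_trans _ _ (2^-1 * r + 2^-1 * r)); last by rewrite -mulrDl; lra.
apply: lerD; rewrite ler_pM2l ?invr_gt0//.
  by apply: le_trans l1; rewrite mulrA ler_pM2r.
apply: le_trans l2; rewrite [leRHS](_ : _ = k2 * C2 *
  ((s ^+ 2) `^ (- A) * powsize tau (d ^+ 2) (s ^+ 2))); last by ring.
by rewrite ler_pM2r// mulr_gt0.
Qed.

End PotentialIntegral.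

(** * The size of the potential integral for large s *)

Section PotentialLarge.
Context {R : realType}.
Local Open Scope classical_set_scope.
Notation mu := (@lebesgue_measure R).
Implicit Types (tau A c s d t : R).

(** Half of the exponent t + c d^2/t is at least a multiple of d; the other half
    keeps the integral in t convergent. The scale of the cut-off is then
    d^2 or, for d > 1, simply 1. *)
Lemma potential_large_le tau A c : 0 < A -> 0 < c ->
  exists C c2 : R, [/\ 0 < C, 0 < c2 & forall s d, 1 <= s -> 0 <= d <= s ->
  (0 < d) || (0 < tau) ->
  (potential tau A c s d <= (C * ((s ^+ 2) `^ (- A) * expR (- (c2 * d)) *
     powsize tau (Num.min (d ^+ 2) 1) 1))%:E)%E].
Proof.
move=> A0 c0.
have ch : 0 < c / 2 by rewrite divr_gt0.
have h2 : 0 < 2^-1 :> R by rewrite invr_gt0.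
have [C1 C10 h1] := integral_cutoff_le tau (c / 2) ch.
have [C3 C30 h3] := @integral_expR_tail_le R (tau - 1) 2^-1 h2.
pose c2 := Num.min 1 c.
have c20 : 0 < c2 by rewrite lt_min ltr01.
have c2c : c2 ^+ 2 <= c.
  rewrite expr2 -[leRHS]mul1r ler_pM ?(ltW c20)// ge_min lexx ?orbT//.
exists (C1 + C3), c2; split; rewrite ?addr_gt0//.
move=> s d s1 /andP[d0 ds] dt.
have s0 : 0 < s by exact: lt_le_trans s1.
have ss0 : 0 < s ^+ 2 by rewrite exprn_gt0.
have dd0 : 0 <= d ^+ 2 by rewrite sqr_ge0.
pose a := Num.min (d ^+ 2) 1.
have a0 : 0 <= a by rewrite le_min dd0 ler01.
have a1 : a <= 1 by rewrite ge_min lexx orbT.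
have ad : a <= d ^+ 2 by rewrite ge_min lexx.
have at0 : (0 < a) || (0 < tau).
  by case/orP: dt => [h|->]; rewrite ?orbT// /a lt_min exprn_gt0 ?ltr01.
have ps1 : 1 <= powsize tau a 1 by apply: powsize_ge1; rewrite ?a0.
rewrite -/a; move: a a0 a1 ad at0 ps1 => a a0 a1 ad at0 ps1.
set K := (s ^+ 2) `^ (- A) * expR (- (c2 * d)).
have K0 : 0 < K by rewrite mulr_gt0 ?powR_gt0 ?expR_gt0.
(* Half of each exponent is spent on the decay in d. *)
have exps t : 0 < t -> expR (- t) * expR (- (c * d ^+ 2 / t)) <=
    expR (- (c2 * d)) * (expR (- (2^-1 * t)) * expR (- (c / 2 * d ^+ 2 / t))).
  move=> t0; rewrite -!expRD ler_expR.
  have tn : t != 0 by rewrite gt_eqF.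
  have h : c2 * d <= 2^-1 * t + c / 2 * d ^+ 2 / t.
    rewrite -(ler_pM2r t0) (_ : (2^-1 * t + _) * t = 2^-1 * (t ^+ 2 + c * d ^+ 2)); last by field.
    have h' : c2 ^+ 2 * d ^+ 2 <= c * d ^+ 2 by rewrite ler_wpM2r.
    have h'' : 0 <= (t - c2 * d) ^+ 2 by rewrite sqr_ge0.
    have e : (t - c2 * d) ^+ 2 = t ^+ 2 - 2 * (c2 * d * t) + c2 ^+ 2 * d ^+ 2 by ring.
    move: h' h''; rewrite e; lra.
  have e : c * d ^+ 2 / t = 2 * (c / 2 * d ^+ 2 / t) by field.
  rewrite e; move: h; move: (c / 2 * d ^+ 2 / t) (c2 * d) => u v; lra.
have potE t : 0 < t -> pot tau A c s d t <=
    K * (expR (- (2^-1 * t)) * t `^ (tau - 1) * expR (- (c / 2 * d ^+ 2 / t))).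
  move=> t0; rewrite /pot.
  rewrite [leLHS](_ : _ = ((t + s ^+ 2) `^ (- A) * t `^ (tau - 1)) *
    (expR (- t) * expR (- (c * d ^+ 2 / t)))); last by ring.
  rewrite [leRHS](_ : _ = ((s ^+ 2) `^ (- A) * t `^ (tau - 1)) * (expR (- (c2 * d)) *
    (expR (- (2^-1 * t)) * expR (- (c / 2 * d ^+ 2 / t))))); last by rewrite /K; ring.
  rewrite ler_pM ?mulr_ge0 ?powR_ge0 ?expR_ge0//; last exact: exps.
  by rewrite ler_wpM2r ?powR_ge0//; apply: le_powRN; rewrite ?(ltW A0)// lerDr ltW.
have low : (\int[mu]_(t in `]0%R, 1%R]) (pot tau A c s d t)%:E <=
    (K * (C1 * powsize tau a 1))%:E)%E.
  apply: (potential_part_le _ _ _ _ _ _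
    (fun t => t `^ (tau - 1) * expR (- (c / 2 * a / t)))).
  - by apply: sub_pos_itv; rewrite /= bnd_simp.
  - exact: posmeasurable_powR_expV.
  - by move=> t _; rewrite mulr_ge0 ?expR_ge0 ?powR_ge0.
  - exact: ltW.
  - move=> t; rewrite in_itv/= => /andP[t0 _].
    apply: (le_trans (potE t t0)); rewrite ler_pM2l// -mulrA.
    rewrite -[leRHS]mul1r ler_pM ?mulr_ge0 ?powR_ge0 ?expR_ge0//.
      by rewrite -[leRHS]expR0 ler_expR oppr_le0 mulr_ge0// ltW.
    rewrite ler_pM2l ?powR_gt0// ler_expR lerN2.
    by rewrite ler_pM2r ?invr_gt0// ler_pM2l.
  - by apply: h1; rewrite ?a0.
have hi : (\int[mu]_(t in `[1%R, +oo[) (pot tau A c s d t)%:E <= (K * C3)%:E)%E.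
  apply: (potential_part_le _ _ _ _ _ _
    (fun t => expR (- (2^-1 * t)) * t `^ (tau - 1))).
  - by apply: sub_pos_itv; rewrite /= bnd_simp.
  - exact: posmeasurable_expN_powR.
  - by move=> t _; rewrite mulr_ge0 ?expR_ge0 ?powR_ge0.
  - exact: ltW.
  - move=> t; rewrite in_itv/= andbT => t1.
    have t0 : 0 < t by exact: lt_le_trans t1.
    apply: (le_trans (potE t t0)); rewrite ler_pM2l//.
    rewrite ler_piMr ?mulr_ge0 ?expR_ge0 ?powR_ge0// -[leRHS]expR0 ler_expR oppr_le0.
    by rewrite divr_ge0 ?(ltW t0)// mulr_ge0 ?(ltW ch) ?dd0.
  - exact: h3.
have mp := posmeasurable_pot tau A c s d.
have pp := pot_ge0 tau A c s d.
rewrite /potential (integral_pos_split _ 1 ltr01 mp pp).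
apply: le_trans; first by apply: leeD hi; exact: low.
rewrite -EFinD lee_fin.
rewrite [leRHS](_ : _ = K * (C1 * powsize tau a 1) + K * (C3 * powsize tau a 1)); last by rewrite /K; ring.
by rewrite lerD2l ler_pM2l// ler_pMr.
Qed.

(** For d <= 1 the interval [d^2, 2] gives the full size. For d > 1 the saddle
    point t = d gives e^(-Cd) up to powers of d, which the exponential
    absorbs. *)
Lemma le_potential_large tau A c : 0 < A -> 0 < c ->
  exists C c1 : R, [/\ 0 < C, 0 < c1 & forall s d, 1 <= s -> 0 < d <= s ->
  ((C * ((s ^+ 2) `^ (- A) * expR (- (c1 * d)) *
     powsize tau (Num.min (d ^+ 2) 1) 1))%:E <= potential tau A c s d)%E].
Proof.
move=> A0 c0.
have [C1 C10 h1] := @le_integral_powR R tau.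
have [C2 C20 h2] := @le_integral_dyadic R tau.
have [D D0 hD] := @powR_le_expR R A 1 (ltW A0) ltr01.
have [E E0 hE] := @powR_le_expR R `|tau| 1 (normr_ge0 _) ltr01.
pose k := expR (- 2) * (3 `^ (- A) * expR (- c)) : R.
have k0 : 0 < k by rewrite /k !mulr_gt0 ?expR_gt0 ?powR_gt0.
pose k' := (D * expR 1 * E)^-1.
have k'0 : 0 < k' by rewrite /k' invr_gt0 !mulr_gt0 ?expR_gt0.
pose c1 := 5 + c.
have c10 : 0 < c1 by rewrite addr_gt0.
exists (Num.min (k * C1) (k' * C2)), c1; split => //.
  by rewrite lt_min (mulr_gt0 k0 C10) (mulr_gt0 k'0 C20).
move=> s d s1 /andP[d0 ds].
have s0 : 0 < s by exact: lt_le_trans s1.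
have ss0 : 0 < s ^+ 2 by rewrite exprn_gt0.
have ss1 : 1 <= s ^+ 2 by rewrite exprn_ege1.
have w0 : 0 < (s ^+ 2) `^ (- A) by rewrite powR_gt0.
have dd0 : 0 < d ^+ 2 by rewrite exprn_gt0.
have base t : 0 < t -> (s ^+ 2) `^ (- A) * (1 + t) `^ (- A) <= (t + s ^+ 2) `^ (- A).
  move=> t0; have t1 : 0 <= 1 + t by rewrite addr_ge0// ltW.
  rewrite -powRM ?(ltW ss0)//; apply: le_powRN; rewrite ?(ltW A0) ?addr_gt0//.
  rewrite mulrDr mulr1 addrC lerD2l ler_peMl// ltW//.
have [d1|d1] := leP d 1.
  have dd1 : d ^+ 2 <= 1 by rewrite exprn_ile1// ltW.
  rewrite (min_idPl dd1).
  have ps : 0 < powsize tau (d ^+ 2) 1 by apply: powsize_gt0; rewrite dd0.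
  apply: (@le_trans _ _ (k * (s ^+ 2) `^ (- A) * (C1 * powsize tau (d ^+ 2) 1))%:E).
    rewrite lee_fin [leRHS](_ : _ = k * C1 * ((s ^+ 2) `^ (- A) * 1 * powsize tau (d ^+ 2) 1)); last by ring.
    apply: ler_pM; rewrite ?mulr_ge0 ?expR_ge0 ?(ltW w0) ?(ltW ps)//.
    - by rewrite le_min (ltW (mulr_gt0 k0 C10)) (ltW (mulr_gt0 k'0 C20)).
    - by rewrite ge_min lexx.
    - rewrite ler_pM2r// ler_pM2l// -[leRHS]expR0 ler_expR oppr_le0.
      by rewrite mulr_ge0// ltW.
  apply: (le_potential_part _ _ _ _ _ `[(d ^+ 2), (2 * 1)]%R
    (fun t => t `^ (tau - 1))).
  - by apply: sub_pos_itv; rewrite /= bnd_simp.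
  - exact: posmeasurable_powR.
  - by move=> t _; exact: powR_ge0.
  - by rewrite mulr_ge0 ?(ltW k0) ?(ltW w0).
  - move=> t; rewrite in_itv/= mulr1 => /andP[dt t2].
    have t0 : 0 < t by exact: lt_le_trans dt.
    rewrite /pot /k -2![leLHS]mulrA -[t `^ _ * _ * expR _]mulrA ler_pM ?expR_ge0 ?mulr_ge0 ?powR_ge0//.
      by rewrite ler_expR lerN2.
    rewrite [leLHS](_ : _ = t `^ (tau - 1) * (((s ^+ 2) `^ (- A) * 3 `^ (- A)) * expR (- c))); last by ring.
    rewrite ler_pM2l ?powR_gt0// ler_pM ?expR_ge0 ?mulr_ge0 ?powR_ge0//.
      apply: le_trans (base t t0); rewrite ler_pM2l//.
      by apply: le_powRN; rewrite ?(ltW A0) ?addr_gt0//; move: t2; lra.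
    by rewrite ler_expR lerN2 ler_pdivrMr// ler_pM2l.
  - by apply: h1; rewrite dd0.
have dd1 : 1 <= d ^+ 2 by rewrite exprn_ege1// ltW.
rewrite (min_idPr dd1).
have -> : powsize tau 1 1 = 1.
  by rewrite /powsize divr1 ln1 addr0 !powR1; case: ifP => // _; case: ifP.
apply: (@le_trans _ _ ((s ^+ 2) `^ (- A) * (expR (- (2 * d)) * ((1 + 2 * d) `^ (- A) *
   expR (- (c * d)))) * (C2 * d `^ tau))%:E).
  have hdt : d `^ (- tau) <= E * expR d.
    have := hE d (ltW d0); rewrite mul1r; apply: le_trans.
    by apply: ler_powR; [exact: ltW|rewrite -normrN ler_norm].
  have hdA : (1 + 2 * d) `^ A <= D * (expR 1 * expR (2 * d)).
    have : 0 <= 1 + 2 * d by rewrite addr_ge0// mulr_ge0// ltW.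
    by move=> /hD; rewrite mul1r expRD.
  rewrite lee_fin mulr1.
  apply: (@le_trans _ _ (k' * C2 * ((s ^+ 2) `^ (- A) * expR (- (c1 * d))))).
    by rewrite ler_pM2r ?mulr_gt0 ?expR_gt0// ge_min lexx orbT.
  rewrite [leLHS](_ : _ = (s ^+ 2) `^ (- A) * (C2 * (k' * expR (- (c1 * d))))); last by ring.
  rewrite [leRHS](_ : _ = (s ^+ 2) `^ (- A) * (C2 * (expR (- (2 * d)) * expR (- (c * d)) *
    ((1 + 2 * d) `^ (- A) * d `^ tau)))); last by ring.
  rewrite ler_pM2l// ler_pM2l//.
  have -> : expR (- (c1 * d)) = expR (- (2 * d)) * expR (- (c * d)) *
     (expR (2 * d) * expR d)^-1.
    by rewrite -(expRD (2 * d) d) -expRN -!expRD; congr expR; rewrite /c1; ring.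
  rewrite mulrCA ler_pM2l ?mulr_gt0 ?expR_gt0//.
  have -> : (1 + 2 * d) `^ (- A) * d `^ tau = ((1 + 2 * d) `^ A * d `^ (- tau))^-1.
    by rewrite !powRN invfM invrK.
  rewrite /k' -invfM lef_pV2 ?posrE ?mulr_gt0 ?powR_gt0 ?expR_gt0//; last first.
    by rewrite addr_gt0// mulr_gt0.
  rewrite [leRHS](_ : _ = D * (expR 1 * expR (2 * d)) * (E * expR d)); last by ring.
  by rewrite ler_pM ?powR_ge0.
apply: (le_potential_part _ _ _ _ _ `[d, (2 * d)]%R (fun t => t `^ (tau - 1))).
- by apply: sub_pos_itv; rewrite /= bnd_simp.
- exact: posmeasurable_powR.
- by move=> t _; exact: powR_ge0.
- by rewrite !mulr_ge0 ?expR_ge0 ?powR_ge0.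
- move=> t; rewrite in_itv/= => /andP[dt td].
  have t0 : 0 < t by exact: lt_le_trans dt.
  rewrite /pot [leLHS](_ : _ = expR (- (2 * d)) * (t `^ (tau - 1) *
    ((s ^+ 2) `^ (- A) * (1 + 2 * d) `^ (- A)) * expR (- (c * d)))); last by ring.
  rewrite ler_pM ?expR_ge0 ?mulr_ge0 ?powR_ge0//; first by rewrite ler_expR lerN2.
  rewrite ler_pM ?expR_ge0 ?mulr_ge0 ?powR_ge0//.
    rewrite ler_pM2l ?powR_gt0//; apply: le_trans (base t t0); rewrite ler_pM2l//.
    by apply: le_powRN; rewrite ?(ltW A0) ?addr_gt0// lerD2l.
  rewrite ler_expR lerN2 ler_pdivrMr// -mulrA ler_pM2l// expr2.
  by rewrite ler_pM2l.
- exact: h2.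
Qed.

End PotentialLarge.

(** * From the kernel to the potential integral *)

Section KernelToPotential.
Context {R : realType}.
Local Open Scope classical_set_scope.
Notation mu := (@lebesgue_measure R).
Implicit Types (alpha sigma A c s d t x y : R).

Let posmeasurable_kernel alpha sigma (b m : R) (f : R -> R) :
  (forall z, {for z, continuous f}) ->
  posmeasurable (fun t => expR (- t) * (2^-1 * (2 * t)^-1 * (4 * t) `^ (- alpha) *
     expR (- (b / (4 * t))) * f (m / (2 * t))) * t `^ (sigma - 1)).
Proof.
move=> cf.
have clin (k x : R) : {for x, continuous (fun t => k * t)}.
  by apply: cvgM; [exact: cvg_cst|exact: cvg_id].
have cinv (k x : R) : 0 < k -> 0 < x -> {for x, continuous (fun t => (k * t)^-1)}.
  by move=> k0 x0; apply: cvgV; [rewrite gt_eqF// mulr_gt0|exact: clin].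
apply: posmeasurableM; last exact: posmeasurable_powR.
apply: posmeasurableM.
  by have := @posmeasurable_expN R 1; under eq_fun do rewrite mul1r.
apply: posmeasurableM; last first.
  apply: continuous_posmeasurable => x x0.
  have h : {for x, continuous (fun t : R => m / (2 * t))}.
    by apply: cvgM; [exact: cvg_cst|exact: cinv].
  exact: (continuous_comp h (cf _)).
apply: posmeasurableM; last first.
  apply: posmeasurable_exp; apply: continuous_posmeasurable => x x0.
  by apply: cvgN; apply: cvgM; [exact: cvg_cst|exact: cinv].
apply: posmeasurableM; last first.
  apply: continuous_posmeasurable => x x0.
  have g : {for 4 * x, continuous (fun t : R => t `^ (- alpha))}.
    by apply: continuous_powR; rewrite mulr_gt0.
  exact: (continuous_comp (clin 4 x) g).
apply: posmeasurableM; first exact: posmeasurable_cst.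
by apply: continuous_posmeasurable => x x0; exact: cinv.
Qed.

Let potential_bounds alpha sigma A (f : R -> R) : - 1 < alpha -> 0 < sigma -> 0 < A ->
  (forall z, {for z, continuous f}) -> (forall z, 0 <= z -> 0 < f z) ->
  (exists c C : R, [/\ 0 < c, 0 < C & forall z, 0 <= z ->
    c * ((1 + z) `^ (- A) * expR z) <= f z <= C * ((1 + z) `^ (- A) * expR z)]) ->
  exists c C : R, [/\ 0 < c, 0 < C & forall x y : R,
   (forall z, (if 0 <= x * y then bessel_plus alpha z else bessel_minus alpha z) = f z) ->
   let s := `|x| + `|y| in let d := `| `|x| - `|y| | in
   (c%:E * potential (sigma + A - alpha - 1)%R A 4^-1%R s d <=
      bessel_potential_kernel alpha sigma x y <=
    C%:E * potential (sigma + A - alpha - 1)%R A 8^-1%R s d)%E].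
Proof.
move=> a1 sg0 A0 cf f0 hf.
have [c [C [c0 C0 hk]]] := growth_kernel_bounds alpha A f A0 hf.
have G0 := Gamma_gt0 sigma sg0.
have Gi : 0 < (Gamma sigma)^-1 by rewrite invr_gt0.
exists ((Gamma sigma)^-1 * c), ((Gamma sigma)^-1 * C).
split; rewrite ?(mulr_gt0 Gi c0) ?(mulr_gt0 Gi C0)// => x y sgn /=.
set s := `|x| + `|y|; set d := `| `|x| - `|y| |.
pose m := `|x| * `|y|.
have m0 : 0 <= m by rewrite mulr_ge0.
have d0 : 0 <= d by rewrite normr_ge0.
have d2 : d ^+ 2 = `|x| ^+ 2 + `|y| ^+ 2 - 2 * m.
  by rewrite /d real_normK ?num_real// /m; ring.
have s2 : s ^+ 2 = d ^+ 2 + 4 * m by rewrite d2 /s /m; ring.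
pose k t := expR (- t) * (2^-1 * (2 * t)^-1 * (4 * t) `^ (- alpha) *
     expR (- ((d ^+ 2 + 2 * m) / (4 * t))) * f (m / (2 * t))) * t `^ (sigma - 1).
have mk : posmeasurable k by exact: posmeasurable_kernel.
have kE : (\int[mu]_(t in `]0%R, +oo[)
     (expR (- t) * dunkl_heat_kernel alpha t x y * t `^ (sigma - 1))%:E =
   \int[mu]_(t in `]0%R, +oo[) (k t)%:E)%E.
  apply: eq_integral => t; rewrite inE/= in_itv/= andbT => t0.
  rewrite dunkl_heat_kernelE// -(_ : d ^+ 2 + 2 * m = `|x| ^+ 2 + `|y| ^+ 2); last first.
    by rewrite d2; ring.
  rewrite /k -/m; congr (_ * _ * _)%:E; congr (_ * _).
  by rewrite -sgn; case: ifP.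
have powE t : 0 < t -> t `^ (sigma + A - alpha - 1 - 1) = t `^ (A - alpha - 1) * t `^ (sigma - 1).
  move=> t0; rewrite -powRD ?(gt_eqF t0) ?implybT//; congr (_ `^ _); ring.
have potE (b t : R) : 0 < t -> pot (sigma + A - alpha - 1) A b s d t =
    expR (- t) * (t `^ (A - alpha - 1) * (t + (d ^+ 2 + 4 * m)) `^ (- A) *
     expR (- (b * d ^+ 2 / t))) * t `^ (sigma - 1).
  by move=> t0; rewrite /pot powE// s2; ring.
have k0 t : 0 < t -> 0 <= k t.
  move=> t0; rewrite /k mulr_ge0 ?powR_ge0// mulr_ge0 ?expR_ge0//.
  rewrite mulr_ge0//; last by rewrite ltW// f0// divr_ge0// mulr_ge0// ltW.
  rewrite mulr_ge0 ?expR_ge0// mulr_ge0 ?powR_ge0// mulr_ge0// invr_ge0.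
  by rewrite mulr_ge0// ltW.
rewrite /bessel_potential_kernel kE !EFinM -!muleA; apply/andP; split.
  apply: lee_wpmul2l; first by rewrite lee_fin ltW.
  rewrite /potential -integral_posZ ?(ltW c0)//; last 2 first.
  - exact: posmeasurable_pot.
  - exact: pot_ge0.
  apply: le_integral_pos => //.
    by apply: posmeasurable_scale; exact: posmeasurable_pot.
  move=> t; rewrite /= in_itv/= andbT => t0.
  rewrite mulr_ge0 ?(ltW c0) ?pot_ge0//= potE//.
  have /andP[h _] := hk t d m t0 d0 m0.
  rewrite mulrA ler_wpM2r ?powR_ge0// mulrCA ler_wpM2l ?expR_ge0//.
apply: lee_wpmul2l; first by rewrite lee_fin ltW.
rewrite /potential -integral_posZ ?(ltW C0)//; last 2 first.
- exact: posmeasurable_pot.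
- exact: pot_ge0.
apply: le_integral_pos => //.
  by apply: posmeasurable_scale; exact: posmeasurable_pot.
move=> t; rewrite /= in_itv/= andbT => t0.
rewrite k0//= potE//.
have /andP[_ h] := hk t d m t0 d0 m0.
by rewrite [leRHS]mulrA ler_wpM2r ?powR_ge0// [leRHS]mulrCA ler_wpM2l ?expR_ge0.
Qed.

Lemma bessel_potential_same_sign alpha sigma : - 2^-1 < alpha -> 0 < sigma ->
  exists c C : R, [/\ 0 < c, 0 < C & forall x y : R, 0 <= x * y ->
   (c%:E * potential (sigma - 2^-1)%R (alpha + 2^-1)%R 4^-1%R (`|x| + `|y|)%R `|x - y|%R <=
      bessel_potential_kernel alpha sigma x y <=
    C%:E * potential (sigma - 2^-1)%R (alpha + 2^-1)%R 8^-1%R (`|x| + `|y|)%R `|x - y|%R)%E].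
Proof.
move=> ha sg0; have a1 : - 1 < alpha by lra.
have A0 : 0 < alpha + 2^-1 by rewrite -ltrBlDr sub0r.
have [c [C [c0 C0 h]]] := potential_bounds alpha sigma _ _ a1 sg0 A0
  (continuous_bessel_plus alpha ha) (bessel_plus_gt0 alpha ha)
  (bessel_plus_bounds alpha ha).
exists c, C; split => // x y xy.
have := h x y; rewrite xy (_ : sigma + (alpha + 2^-1) - alpha - 1 = sigma - 2^-1); last by field.
have -> : `|x - y| = `| `|x| - `|y| |.
  have [x0|x0] := leP 0 x; have [y0|y0] := leP 0 y.
  - by rewrite (ger0_norm x0) (ger0_norm y0).
  - have : x * y <= 0 by rewrite mulr_ge0_le0// ltW.
    rewrite le_eqVlt ltNge xy orbF mulf_eq0 (lt_eqF y0) orbF => /eqP->.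
    by rewrite normr0 !sub0r !normrN normr_id.
  - have : x * y <= 0 by rewrite mulr_le0_ge0// ltW.
    rewrite le_eqVlt ltNge xy orbF mulf_eq0 (lt_eqF x0)/= => /eqP->.
    by rewrite normr0 !subr0 normr_id.
  - by rewrite (ltr0_norm x0) (ltr0_norm y0) -[LHS]normrN opprB opprK addrC.
by apply.
Qed.

Lemma bessel_potential_opposite_sign alpha sigma : - 2^-1 < alpha -> 0 < sigma ->
  exists c C : R, [/\ 0 < c, 0 < C & forall x y : R, x * y < 0 ->
   (c%:E * potential (sigma + 2^-1)%R (alpha + 2^-1 + 1)%R 4^-1%R (`|x| + `|y|)%R `|x + y|%R <=
      bessel_potential_kernel alpha sigma x y <=
    C%:E * potential (sigma + 2^-1)%R (alpha + 2^-1 + 1)%R 8^-1%R (`|x| + `|y|)%R `|x + y|%R)%E].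
Proof.
move=> ha sg0; have a1 : - 1 < alpha by lra.
have A0 : 0 < alpha + 2^-1 + 1 by lra.
have [c [C [c0 C0 h]]] := potential_bounds alpha sigma _ _ a1 sg0 A0
  (continuous_bessel_minus alpha ha) (bessel_minus_gt0 alpha ha)
  (bessel_minus_bounds alpha ha).
exists c, C; split => // x y xy.
have := h x y; rewrite leNgt xy (_ : sigma + (alpha + 2^-1 + 1) - alpha - 1 = sigma + 2^-1); last by field.
have -> : `|x + y| = `| `|x| - `|y| |.
  have [x0|x0] := leP 0 x; have [y0|y0] := leP 0 y.
  - by move: xy; rewrite ltNge mulr_ge0.
  - by rewrite (ger0_norm x0) (ltr0_norm y0) opprK.
  - by rewrite (ltr0_norm x0) (ger0_norm y0) -normrN opprD.
  - by move: xy; rewrite ltNge mulr_le0 ?ltW.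
by apply.
Qed.

End KernelToPotential.

(** * Divergence of the potential integral *)

Section Degenerate.
Context {R : realType}.
Local Open Scope classical_set_scope.
Implicit Types (tau A c s d : R).

(** With d = r e^(-N) the logarithm is linear in N and the power is exponential
    in N. *)
Lemma powsize_unbounded (p r b K : R) : p <= 0 -> 0 < r -> 0 < b -> r ^+ 2 <= b ->
  exists2 d : R, 0 < d <= r & K <= powsize p (d ^+ 2) b.
Proof.
move=> p0 r0 b0 rb.
have [->|pn] := eqVneq p 0.
  have e1 : expR (- `|K|) <= 1 by rewrite -[leRHS]expR0 ler_expR oppr_le0.
  exists (r * expR (- `|K|)); first by rewrite mulr_gt0 ?expR_gt0//= ler_piMr ?(ltW r0).
  rewrite /powsize ltxx eqxx exprMn.
  have rn : r ^+ 2 != 0 by rewrite gt_eqF// exprn_gt0.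
  have -> : b / (r ^+ 2 * expR (- `|K|) ^+ 2) = (b / r ^+ 2) * (expR `|K| ^+ 2).
    by rewrite invfM expRN exprVn invrK mulrA.
  have r2 : 0 < r ^+ 2 by rewrite exprn_gt0.
  rewrite lnM ?posrE ?divr_gt0 ?exprn_gt0 ?expR_gt0//.
  rewrite [expR _ ^+ 2]expr2 [ln (expR _ * _)]lnM ?posrE ?expR_gt0// expRK.
  have : 0 <= ln (b / r ^+ 2) by rewrite ln_ge0// ler_pdivlMr// mul1r.
  by have := normr_ge0 K; have := ler_norm K; lra.
have {}p0 : p < 0 by rewrite lt_neqAle pn.
have r2 : 0 < (r ^+ 2) `^ p by rewrite powR_gt0// exprn_gt0.
pose N := `|K| / ((r ^+ 2) `^ p * (- p *+ 2)).
have N0 : 0 <= N by rewrite divr_ge0// mulr_ge0 ?(ltW r2)// mulrn_wge0// oppr_ge0 ltW.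
have e1 : expR (- N) <= 1 by rewrite -[leRHS]expR0 ler_expR oppr_le0.
exists (r * expR (- N)); first by rewrite mulr_gt0 ?expR_gt0//= ler_piMr ?(ltW r0).
rewrite /powsize [0 < p]ltNge (ltW p0)/= (negbTE pn) exprMn.
rewrite powRM ?sqr_ge0//.
have -> : (expR (- N) ^+ 2) `^ p = expR (N * (- p *+ 2)).
  rewrite -powR_mulrn ?expR_ge0// -powRrM -expRM; congr expR.
  by rewrite -mulr_natr; ring.
apply: (@le_trans _ _ ((r ^+ 2) `^ p * (1 + N * (- p *+ 2)))); last first.
  by rewrite ler_pM2l// expR_ge1Dx.
rewrite mulrDr mulr1 [X in _ + X](_ : _ = `|K|).
  by rewrite (le_trans (ler_norm K))// lerDr ltW.
rewrite /N; move: r2; move: (_ `^ p) => w w0.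
by field; rewrite (gt_eqF w0) pn.
Qed.

Lemma ereal_infty_of_unbounded (X : \bar R) : (forall K : R, (K%:E <= X)%E) -> X = +oo%E.
Proof.
case: X => [r|//|] h; first by have := h (r + 1); rewrite lee_fin gerDl ler10.
by have := h 0; rewrite leNgt ltNyr.
Qed.

(** The integral at d = 0 exceeds the lower bounds for all small d, by
    monotonicity. *)
Lemma potential_diag_infty tau A c s : 0 < A -> 0 < c -> tau <= 0 -> 0 < s <= 1 ->
  potential tau A c s 0 = +oo%E.
Proof.
move=> A0 c0 t0 /andP[s0 s1]; apply: ereal_infty_of_unbounded => K.
have [C C0 hC] := le_potential_small tau A c A0 c0.
have w0 : 0 < (s ^+ 2) `^ (- A) by rewrite powR_gt0// exprn_gt0.
have [d /andP[d0 ds] hd] := powsize_unbounded tau s (s ^+ 2)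
  (K / (C * (s ^+ 2) `^ (- A))) t0 s0 (exprn_gt0 _ s0) (lexx _).
have h1 : 0 <= s <= s by rewrite (ltW s0)/=.
have h2 : (0 : R) <= 0 <= d by rewrite lexx ltW.
apply: le_trans (potential_antitone tau A c s 0 s d A0 c0 h1 h2).
have hs : 0 < s <= 1 by rewrite s0.
have hds : 0 < d <= s by rewrite d0.
apply: le_trans (hC s d hs hds); rewrite lee_fin.
apply: (@le_trans _ _ (C * (s ^+ 2) `^ (- A) * powsize tau (d ^+ 2) (s ^+ 2))).
  by rewrite mulrC -ler_pdivrMr// mulr_gt0.
rewrite -mulrA ler_pM2l// lerDr ltW//; apply: powsize_gt0.
by rewrite exprn_gt0//= exprn_ile1// ltW.
Qed.

(** Here the lower bounds are those on the diagonal s = d, for s tending to 0. *)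
Lemma potential_origin_infty tau A c : 0 < A -> 0 < c -> tau <= A ->
  potential tau A c 0 0 = +oo%E.
Proof.
move=> A0 c0 tA; apply: ereal_infty_of_unbounded => K.
have [C C0 hC] := le_potential_small tau A c A0 c0.
have p0 : tau - A <= 0 by rewrite subr_le0.
have b1 : 1 ^+ 2 <= 1 :> R by rewrite expr1n.
have [s /andP[s0 s1] hd] := powsize_unbounded (tau - A) 1 1 (K / C) p0 ltr01 ltr01 b1.
have h1 : (0 : R) <= 0 <= s by rewrite lexx ltW.
apply: le_trans (potential_antitone tau A c 0 0 s s A0 c0 h1 h1).
have hs : 0 < s <= 1 by rewrite s0.
have hds : 0 < s <= s by rewrite s0 lexx.
apply: le_trans (hC s s hs hds); rewrite lee_fin.
apply: (@le_trans _ _ (C * powsize (tau - A) (s ^+ 2) 1)).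
  by rewrite mulrC -ler_pdivrMr.
rewrite ler_pM2l// lerDl mulr_ge0 ?powR_ge0// ltW//; apply: powsize_gt0.
by rewrite exprn_gt0//= exprn_ile1// ltW.
Qed.

End Degenerate.

(** * Comparison for small s *)

Section SmallScale.
Context {R : realType}.
Local Open Scope classical_set_scope.
Implicit Types (tau A c s d : R).

(** The right-hand sides for |x| + |y| <= 1, for both signs of xy: when xy < 0
    then tau > 0, and only the last branch occurs. *)
Definition small_size tau A s d : \bar R :=
  (chi R (A < tau)%R + chi R (tau == A) * lne (equot 1%R s)
   + (if (tau < 0)%R then epow s (- 2 * A)%R * epow d (2 * tau)%R
      else if tau == 0%R then epow s (- 2 * A)%R * lne (equot (2 * s)%R d)
      else epow s (2 * (tau - A))%R))%E.

Let powR_sqr (x a : R) : 0 <= x -> x `^ (2 * a) = (x ^+ 2) `^ a.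
Proof. by move=> x0; rewrite powRrM powR_mulrn. Qed.

Let epow_pos (x a : R) : 0 < x -> epow x a = (x `^ a)%:E.
Proof. by move=> x0; rewrite /epow gt_eqF. Qed.

Let equot_pos (x y : R) : 0 < y -> equot x y = (x / y)%:E.
Proof. by move=> y0; rewrite /equot gt_eqF. Qed.

Let ln2_gt0 : 0 < ln 2 :> R. Proof. by rewrite ln_gt0// ltr1n. Qed.

Let ln2_le1 : ln 2 <= 1 :> R.
Proof. by rewrite -ler_expR lnK ?posrE// (le_trans _ (expR_ge1Dx _)). Qed.

(** Of the two terms with [powsize], for tau <= 0 the second dominates since
    s^(2(tau-A)) <= s^(-2A) d^(2 tau); for tau > 0 they amount to the terms in chi
    and the power of s. The constant has to turn 1 + 2 log(s/d) into log(2s/d), which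
    stays above log 2 only. *)
Lemma small_sizeE tau A : 0 < A -> exists2 C : R, 0 < C & forall s d,
  0 < s <= 1 -> 0 <= d <= s -> (0 < d) || (0 < tau) ->
  exists y : R, [/\ small_size tau A s d = y%:E,
    powsize (tau - A) (s ^+ 2) 1 +
      (s ^+ 2) `^ (- A) * powsize tau (d ^+ 2) (s ^+ 2) <= C * y &
    y <= C * (powsize (tau - A) (s ^+ 2) 1 +
      (s ^+ 2) `^ (- A) * powsize tau (d ^+ 2) (s ^+ 2))].
Proof.
move=> A0; exists (2 * (2 + (ln 2)^-1)).
  by rewrite mulr_gt0// addr_gt0// invr_gt0.
move=> s d /andP[s0 s1] /andP[d0 ds] dt.
have l2 : 0 < (ln 2)^-1 :> R by rewrite invr_gt0.
have k1 : 2 <= 2 * (2 + (ln 2)^-1) :> R by lra.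
have ss0 : 0 < s ^+ 2 by rewrite exprn_gt0.
have w0 : 0 < (s ^+ 2) `^ (- A) by rewrite powR_gt0.
have wt : (s ^+ 2) `^ (- A) * (s ^+ 2) `^ tau = (s ^+ 2) `^ (tau - A).
  by rewrite -powRD ?(gt_eqF ss0) ?implybT// addrC.
have A2 : - 2 * A = 2 * (- A) by ring.
rewrite /small_size A2 (epow_pos s _ s0) (epow_pos s (2 * (tau - A)) s0) (equot_pos 1 s s0).
rewrite !(powR_sqr s _ (ltW s0)).
have [t0|t0|t0] := ltrgtP tau 0.
- have tA : tau < A by exact: lt_trans A0.
  rewrite ltNge (ltW tA)/= (lt_eqF tA).
  have d1 : 0 < d by move: dt; rewrite [0 < tau]ltNge (ltW t0) orbF.
  rewrite (epow_pos d _ d1) (powR_sqr d _ d0) /chi mul0e !add0e -EFinM.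
  eexists; split; first reflexivity.
    rewrite /powsize subr_gt0 [A < tau]ltNge (ltW tA) subr_eq0 (lt_eqF tA)/=.
    rewrite [0 < tau]ltNge (ltW t0) (lt_eqF t0)/=.
    have h : (s ^+ 2) `^ (tau - A) <= (s ^+ 2) `^ (- A) * (d ^+ 2) `^ tau.
      rewrite -wt ler_pM2l// -[tau]opprK; apply: le_powRN.
      - by rewrite oppr_ge0 ltW.
      - by rewrite exprn_gt0.
      - by rewrite ler_sqr ?nnegrE// ltW.
    apply: (@le_trans _ _ (2 * ((s ^+ 2) `^ (- A) * (d ^+ 2) `^ tau))); first by lra.
    by rewrite ler_wpM2r// mulr_ge0 ?powR_ge0.
  rewrite /powsize [0 < tau]ltNge (ltW t0) (lt_eqF t0)/=.
  have ps : 0 < powsize (tau - A) (s ^+ 2) 1 by apply: powsize_gt0; rewrite ss0 exprn_ile1// ltW.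
  rewrite /powsize in ps.
  have y0 : 0 <= (s ^+ 2) `^ (- A) * (d ^+ 2) `^ tau by rewrite mulr_ge0 ?powR_ge0.
  apply: (@le_trans _ _ (1 * ((s ^+ 2) `^ (- A) * (d ^+ 2) `^ tau))); first by rewrite mul1r.
  apply: ler_pM => //; first by lra.
  by rewrite lerDr ltW.
- rewrite /powsize t0 wt subr_gt0 subr_eq0.
  have [tA|tA|tA] := ltrgtP tau A.
  + rewrite /chi mul0e !add0e.
    have X0 := powR_ge0 (s ^+ 2) (tau - A); have := ler_wpM2r X0 k1.
    move: (_ `^ _) X0 => X X0 h.
    by eexists; split; [reflexivity| |]; lra.
  + rewrite /chi mul0e adde0 -EFinD powR1 mulr1n.
    have X0 := powR_ge0 (s ^+ 2) (tau - A); have := ler_wpM2r X0 k1.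
    move: (_ `^ _) X0 => X X0 h.
    by eexists; split; [reflexivity| |]; lra.
  + rewrite tA subrr powRr0 /chi mul1e add0e div1r lne_EFin ?invr_gt0// -EFinD.
    rewrite div1r -exprVn expr2 lnM ?posrE ?invr_gt0//.
    have L0 : 0 <= ln s^-1 by rewrite ln_ge0// invf_ge1.
    have := ler_wpM2r L0 k1; move: (ln s^-1) L0 => L L0 h.
    by eexists; split; [reflexivity| |]; lra.
- have tA : tau < A by rewrite t0.
  rewrite ltNge (ltW tA)/= (lt_eqF tA).
  have d1 : 0 < d by move: dt; rewrite t0 ltxx orbF.
  have sd : 0 < s / d by rewrite divr_gt0.
  rewrite (equot_pos _ d d1) lne_EFin ?divr_gt0 ?mulr_gt0// /chi mul0e !add0e -EFinM.
  have d2 : 0 < d ^+ 2 by rewrite exprn_gt0.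
  rewrite /powsize subr_gt0 [A < tau]ltNge (ltW tA) subr_eq0 (lt_eqF tA)/=.
  rewrite -wt t0 ltxx eqxx powRr0 mulr1 -[2 * s / d]mulrA.
  rewrite [ln (2 * _)]lnM ?posrE// -expr_div_n expr2 [ln (s / d * (s / d))]lnM ?posrE//.
  have L0 : 0 <= ln (s / d) by rewrite ln_ge0// ler_pdivlMr// mul1r.
  move: (ln (s / d)) L0 => L L0.
  move: (_ `^ _) w0 => w w0.
  have e : (ln 2)^-1 * ln 2 = 1 :> R by rewrite mulVf// gt_eqF.
  have h : 0 <= (ln 2)^-1 * L by rewrite mulr_ge0// ltW.
  have -> : w + w * (1 + (L + L)) = w * (1 + (1 + (L + L))) by ring.
  exists (w * (ln 2 + L)); split; first by [].
    rewrite mulrCA ler_pM2l//.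
    rewrite [leRHS](_ : _ = 4 * ln 2 + 4 * L + 2 * ((ln 2)^-1 * ln 2) + 2 * ((ln 2)^-1 * L)); last by ring.
    by rewrite e; move: ln2_gt0; lra.
  rewrite mulrCA ler_pM2l//.
  apply: (@le_trans _ _ (1 * (1 + (1 + (L + L))))); first by move: ln2_le1; lra.
  by rewrite ler_wpM2r//; lra.
Qed.

Lemma small_size_diag tau A s : 0 < A -> tau <= 0 -> 0 < s ->
  small_size tau A s 0 = +oo%E.
Proof.
move=> A0 t0 s0; have tA : tau < A by exact: le_lt_trans A0.
rewrite /small_size ltNge (ltW tA)/= (lt_eqF tA) /chi mul0e !add0e.
rewrite (epow_pos s _ s0) /epow /equot eqxx/=.
have w : (0 < (s `^ (- 2 * A))%:E)%E by rewrite lte_fin powR_gt0.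
have [tn|tn|_] := ltrgtP tau 0.
- by rewrite pmulr_rlt0// tn gt0_muley.
- by move: t0; rewrite leNgt tn.
- by rewrite /= gt0_muley.
Qed.

Lemma small_size_origin tau A : 0 < A -> tau <= A -> small_size tau A 0 0 = +oo%E.
Proof.
move=> A0 tA; rewrite /small_size ltNge tA/= /chi add0e.
have [e|tn] := eqVneq tau A.
  have t0 : 0 < tau by rewrite e.
  rewrite [tau < 0]ltNge (ltW t0)/= (gt_eqF t0) /equot eqxx/= mul1e e subrr mulr0.
  by rewrite /epow ltxx andbF.
have {tn}tA' : tau < A by rewrite lt_neqAle tn.
rewrite mul0e add0e /epow /equot eqxx/=.
have -> : - 2 * A < 0 by rewrite mulNr oppr_lt0 mulr_gt0.
have [t0|t0|_] := ltrgtP tau 0.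
- by rewrite pmulr_rlt0// t0 mulyy.
- by rewrite pmulr_rlt0// subr_lt0 tA'.
- by rewrite /= mulyy.
Qed.

Lemma small_size_origin1 tau A : 0 < A -> A < tau -> small_size tau A 0 0 = 1%E.
Proof.
move=> A0 tA; have t0 : 0 < tau by exact: lt_trans tA.
rewrite /small_size tA (gt_eqF tA) [tau < 0]ltNge (ltW t0)/= (gt_eqF t0).
rewrite /chi mul0e adde0 /epow eqxx pmulr_rlt0// subr_lt0 [tau < A]ltNge (ltW tA)/=.
by rewrite powR0 ?adde0// mulf_neq0// gt_eqF// subr_gt0.
Qed.

Lemma potential_small_comparable tau A c : 0 < A -> 0 < c ->
  exists C c' : R, [/\ 0 < C, 0 < c' & forall s d, 0 <= s <= 1 -> 0 <= d <= s ->
  (c'%:E * small_size tau A s d <= potential tau A c s d <=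
   C%:E * small_size tau A s d)%E].
Proof.
move=> A0 c0.
have [K K0 hK] := small_sizeE tau A A0.
have [C1 C10 h1] := potential_small_le tau A c A0 c0.
have [C2 C20 h2] := le_potential_small tau A c A0 c0.
(* The constant for the origin, where the integral may be finite. *)
have [C3 C30 h3] : exists2 C3 : R, 0 < C3 & A < tau -> (potential tau A c 0 0 <= C3%:E)%E.
  have [tA|tA] := ltP A tau; last by exists 1.
  by have [C3 C30 h] := potential_bounded tau A c A0 c0 tA; exists C3.
have h11 : (0 : R) < (1 : R) <= (1 : R) by rewrite ltr01 lexx.
have h01 : (0 : R) <= (0 : R) <= (1 : R) by rewrite lexx ler01.
have C4 : ((C2 * 1)%:E <= potential tau A c 0 0)%E.
  apply: le_trans (potential_antitone tau A c 0 0 1 1 A0 c0 h01 h01).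
  apply: le_trans (h2 1 1 h11 h11); rewrite lee_fin ler_pM2l// expr1n.
  rewrite (le_trans (powsize_ge1 (tau - A) 1 _ _)) ?ler01 ?lexx ?ltr01//.
  by rewrite lerDl powR1 mul1r ltW// powsize_gt0.
exists (C1 * K + C3), (Num.min (C2 / K) C2).
have CC : 0 < C1 * K + C3 by rewrite addr_gt0 ?mulr_gt0.
have cc : 0 < Num.min (C2 / K) C2 by rewrite lt_min divr_gt0.
split=> // s d /andP[s0 s1] /andP[d0 ds].
have [s'|] := boolP (0 < s); last first.
  rewrite -leNgt => s'; have es : s = 0 by apply/le_anti; rewrite s'.
  have ed : d = 0 by apply/le_anti; rewrite d0 andbT -es.
  rewrite es ed; have [tA|tA] := leP tau A.
    by rewrite small_size_origin// potential_origin_infty// !gt0_muley ?lte_fin ?lexx.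
  rewrite small_size_origin1// !mule1; apply/andP; split.
    by apply: le_trans C4; rewrite lee_fin mulr1 ge_min lexx orbT.
  by apply: (le_trans (h3 tA)); rewrite lee_fin lerDr mulr_ge0 ?(ltW C10) ?(ltW K0).
have s01 : 0 < s <= 1 by rewrite s'.
have d0s : 0 <= d <= s by rewrite d0.
have ss0 : 0 < s ^+ 2 by rewrite exprn_gt0.
have [dt|] := boolP ((0 < d) || (0 < tau)); last first.
  rewrite negb_or -!leNgt => /andP[d' t0].
  have -> : d = 0 by apply/le_anti; rewrite d0 d'.
  by rewrite small_size_diag// potential_diag_infty// !gt0_muley ?lte_fin ?lexx.
have [y [-> l1 l2]] := hK s d s01 d0s dt.
have up := h1 s d s01 d0s dt.
have lo : ((C2 * (powsize (tau - A) (s ^+ 2) 1 +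
      (s ^+ 2) `^ (- A) * powsize tau (d ^+ 2) (s ^+ 2)))%:E <=
    potential tau A c s d)%E.
  have [d'|d'] := ltP 0 d; first by apply: h2; rewrite ?d'.
  have t0 : 0 < tau by move: dt; rewrite [0 < d]ltNge d'.
  have ssE : 0 < s <= s by rewrite s' lexx.
  have s0s : 0 <= s <= s by rewrite s0 lexx.
  apply: le_trans (potential_antitone tau A c s d s s A0 c0 s0s d0s).
  by apply: le_trans (h2 s s s01 ssE); rewrite /powsize t0.
have L0 : 0 < powsize (tau - A) (s ^+ 2) 1 +
      (s ^+ 2) `^ (- A) * powsize tau (d ^+ 2) (s ^+ 2).
  have ps : 0 < powsize (tau - A) (s ^+ 2) 1.
    by apply: powsize_gt0; rewrite ss0 exprn_ile1// ltW.
  rewrite ltr_pwDl// mulr_ge0 ?powR_ge0// /powsize; case: ifP => [_|/negbT].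
    exact: powR_ge0.
  rewrite -leNgt => t0; case: ifP => _; last exact: powR_ge0.
  have d' : 0 < d by move: dt; rewrite [0 < tau]ltNge t0 orbF.
  rewrite addr_ge0// ln_ge0// ler_pdivlMr ?exprn_gt0// mul1r.
  by rewrite ler_sqr ?nnegrE// ltW.
move: (_ + _ * _) L0 up lo l1 l2 => L L0 up lo l1 l2.
have y0 : 0 < y by have := lt_le_trans L0 l1; rewrite pmulr_rgt0.
apply/andP; split.
  apply: le_trans lo; rewrite -EFinM lee_fin.
  apply: (@le_trans _ _ (C2 / K * y)); first by rewrite ler_pM2r// ge_min lexx.
  by rewrite -mulrA ler_pM2l// mulrC ler_pdivrMr// mulrC.
apply: (le_trans up); rewrite -EFinM lee_fin.
apply: (@le_trans _ _ (C1 * K * y)); first by rewrite -mulrA ler_pM2l.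
by rewrite ler_pM2r// lerDl ltW.
Qed.

End SmallScale.

(** * Comparison for large s *)

Section LargeScale.
Context {R : realType}.
Local Open Scope classical_set_scope.
Implicit Types (tau A c s d : R).

(** The factor depending on |x - y| for |x| + |y| > 1; when xy < 0 then tau > 0
    and it is 1. *)
Definition large_factor tau d : \bar R :=
  (if (tau < 0)%R then epow d (2 * tau)%R
   else if tau == 0%R then 1 + maxe (lne (equot 1%R d)) 0 else 1)%E.

Definition large_size tau A s d : \bar R :=
  (epow s (- 2 * A)%R * large_factor tau d)%E.

(** For tau < 0 and d > 1 the two sides differ by a power of d, which an
    exponential with an arbitrarily small constant absorbs. *)
Lemma large_factorE tau (e : R) : 0 < e -> exists2 K : R, 0 < K & forall d,
  0 <= d -> (0 < d) || (0 < tau) -> exists b : R,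
  [/\ large_factor tau d = b%:E, 0 < b, b <= K * powsize tau (Num.min (d ^+ 2) 1) 1 &
    powsize tau (Num.min (d ^+ 2) 1) 1 <= K * (b * expR (e * d))].
Proof.
move=> e0.
have N0 : 0 <= 2 * `|tau| by rewrite mulr_ge0.
have [D D0 hD] := powR_le_expR (2 * `|tau|) e N0 e0.
exists (2 + D); first by rewrite addr_gt0.
move=> d d0 dt.
have ed : 1 <= expR (e * d) by rewrite -[leLHS]expR0 ler_expR mulr_ge0// ltW.
have step (b p : R) : 0 < b -> p <= 2 * b -> p <= (2 + D) * (b * expR (e * d)).
  move=> b0 pb; apply: (le_trans pb); rewrite ler_pM ?(ltW b0)//; first by rewrite lerDl ltW.
  by rewrite ler_peMr// ltW.
have step' (b p : R) : 0 < p -> b <= p -> b <= (2 + D) * p.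
  by move=> p0 bp; rewrite (le_trans bp)// ler_peMl ?(ltW p0)//; lra.
rewrite /large_factor /powsize.
have [t0|t0|t0] := ltrgtP tau 0.
- have d1 : 0 < d by move: dt; rewrite [0 < tau]ltNge (ltW t0) orbF.
  have dd : 0 < d ^+ 2 by rewrite exprn_gt0.
  have b0 : 0 < d `^ (2 * tau) by rewrite powR_gt0.
  exists (d `^ (2 * tau)); rewrite /epow (gt_eqF d1)/=; split=> //.
    have e2 : d `^ (2 * tau) = (d ^+ 2) `^ tau by rewrite powRrM powR_mulrn.
    apply: step'; first by rewrite powR_gt0// lt_min dd ltr01.
    rewrite e2 -[tau]opprK; apply: le_powRN; rewrite ?oppr_ge0 ?(ltW t0)//.
      by rewrite lt_min dd ltr01.
    by rewrite ge_min lexx.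
  have [d1'|d1'] := leP d 1.
    rewrite (min_idPl _) ?exprn_ile1//.
    have -> : (d ^+ 2) `^ tau = d `^ (2 * tau) by rewrite powRrM powR_mulrn.
    by apply: step => //; lra.
  rewrite (min_idPr _) ?exprn_ege1 ?(ltW d1')// powR1.
  have h := hD d d0.
  rewrite -ler_pdivrMl ?addr_gt0// mulr1.
  have w1 : 1 = d `^ (2 * tau) * d `^ (2 * `|tau|).
    rewrite -powRD ?(gt_eqF d1) ?implybT// ltr0_norm//.
    by rewrite mulrN subrr powRr0.
  have h' : d `^ (2 * tau) * d `^ (2 * `|tau|) <= d `^ (2 * tau) * (D * expR (e * d)).
    by rewrite ler_pM2l.
  rewrite -w1 in h'.
  rewrite -div1r ler_pdivrMr ?addr_gt0//; apply: (le_trans h').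
  rewrite [leLHS](_ : _ = d `^ (2 * tau) * expR (e * d) * D); last by ring.
  by rewrite ler_pM2l ?mulr_gt0 ?expR_gt0// lerDr.
- exists 1; rewrite powR1; split => //; first by apply: step'.
  by apply: step => //; lra.
- have d1 : 0 < d by move: dt; rewrite t0 ltxx orbF.
  have dd : 0 < d ^+ 2 by rewrite exprn_gt0.
  rewrite /equot (gt_eqF d1) lne_EFin ?divr_gt0// -EFin_max -EFinD.
  exists (1 + Num.max (ln (1 / d)) 0).
  have b0 : 0 < 1 + Num.max (ln (1 / d)) 0 by rewrite ltr_pwDl// le_max lexx orbT.
  have [d1'|d1'] := leP d 1.
    have L0 : 0 <= ln (1 / d) by rewrite ln_ge0// ler_pdivlMr// mul1r.
    rewrite (min_idPl _) ?exprn_ile1// (max_idPl L0).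
    have -> : 1 / d ^+ 2 = 1 / d * (1 / d) by field; rewrite gt_eqF.
    rewrite [ln (1 / d * (1 / d))]lnM ?posrE ?divr_gt0//.
    rewrite (max_idPl L0) in b0.
    split => //; [apply: step'; lra|apply: step => //; lra].
  have L0 : ln (1 / d) <= 0.
    by rewrite -ln1 ler_ln ?posrE ?divr_gt0// ler_pdivrMr// mul1r ltW.
  rewrite (min_idPr _) ?exprn_ege1 ?(ltW d1')// (max_idPr L0) divr1 ln1 addr0.
  split => //; first by apply: step'.
  by apply: step => //; lra.
Qed.

(** As for s <= 1, by letting d tend to 0 in the lower bound. *)
Lemma potential_diag_large_infty tau A c s : 0 < A -> 0 < c -> tau <= 0 -> 1 <= s ->
  potential tau A c s 0 = +oo%E.
Proof.
move=> A0 c0 t0 s1; apply: ereal_infty_of_unbounded => K.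
have s0 : 0 < s by exact: lt_le_trans s1.
have [C [c1 [C0 c10 hC]]] := le_potential_large tau A c A0 c0.
pose w := (s ^+ 2) `^ (- A) * expR (- c1).
have w0 : 0 < w by rewrite mulr_gt0 ?expR_gt0// powR_gt0// exprn_gt0.
have b1 : 1 ^+ 2 <= 1 :> R by rewrite expr1n.
have [d /andP[d0 d1] hd] := powsize_unbounded tau 1 1 (K / (C * w)) t0 ltr01 ltr01 b1.
have h1 : 0 <= s <= s by rewrite (ltW s0)/=.
have h2 : (0 : R) <= (0 : R) <= d by rewrite lexx ltW.
apply: le_trans (potential_antitone tau A c s 0 s d A0 c0 h1 h2).
have hds : 0 < d <= s by rewrite d0 (le_trans d1).
apply: le_trans (hC s d s1 hds); rewrite lee_fin.
have dd1 : d ^+ 2 <= 1 by rewrite exprn_ile1// ltW.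
have ps : 0 < powsize tau (d ^+ 2) 1 by apply: powsize_gt0; rewrite exprn_gt0.
rewrite (min_idPl dd1).
apply: (@le_trans _ _ (C * w * powsize tau (d ^+ 2) 1)).
  by rewrite mulrC -ler_pdivrMr// mulr_gt0.
rewrite -mulrA ler_pM2l// ler_pM2r// /w ler_pM2l ?powR_gt0 ?exprn_gt0//.
by rewrite ler_expR lerN2 -[leRHS]mulr1 ler_pM2l.
Qed.

Lemma large_size_diag tau A s : tau <= 0 -> 0 < s -> large_size tau A s 0 = +oo%E.
Proof.
move=> t0 s0; rewrite /large_size /large_factor /epow /equot (gt_eqF s0) eqxx/=.
have w : (0 < (s `^ (- 2 * A))%:E)%E by rewrite lte_fin powR_gt0.
have [tn|tn|_] := ltrgtP tau 0.
- by rewrite pmulr_rlt0// tn gt0_muley.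
- by move: t0; rewrite leNgt tn.
- by rewrite /= maxye gt0_muley.
Qed.

(** At d = 0 with tau > 0 the lower bound at d = 1 is used instead, which costs
    the factor e^(-c1). *)
Lemma potential_large_comparable tau A c : 0 < A -> 0 < c ->
  exists C c' c1 c2 : R, [/\ 0 < C, 0 < c', 0 < c1, 0 < c2 &
  forall s d, 1 <= s -> 0 <= d <= s ->
  (c'%:E * (large_size tau A s d * (expR (- (c1 * d)))%R%:E) <= potential tau A c s d <=
   C%:E * (large_size tau A s d * (expR (- (c2 * d)))%R%:E))%E].
Proof.
move=> A0 c0.
have [C [c2 [C0 c20 hC]]] := potential_large_le tau A c A0 c0.
have [C' [c1 [C'0 c10 hC']]] := le_potential_large tau A c A0 c0.
have ch : 0 < c2 / 2 by rewrite divr_gt0.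
have [K K0 hK] := large_factorE tau (c2 / 2) ch.
exists (C * K), (C' / K * expR (- c1)), c1, (c2 / 2).
split; rewrite ?mulr_gt0 ?invr_gt0 ?expR_gt0// => s d s1 /andP[d0 ds].
have s0 : 0 < s by exact: lt_le_trans s1.
have [dt|] := boolP ((0 < d) || (0 < tau)); last first.
  rewrite negb_or -!leNgt => /andP[d' t0].
  have -> : d = 0 by apply/le_anti; rewrite d0 d'.
  rewrite large_size_diag// potential_diag_large_infty// !mulr0 oppr0 expR0 mule1.
  by rewrite !gt0_muley ?lte_fin ?mulr_gt0 ?invr_gt0 ?expR_gt0 ?lexx.
have [b [bE b0 b1 b2]] := hK d d0 dt.
have ww : s `^ (- 2 * A) = (s ^+ 2) `^ (- A).
  by rewrite [- 2 * A](_ : _ = 2 * (- A)) ?powRrM ?powR_mulrn ?(ltW s0)//; ring.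
rewrite /large_size bE /epow (gt_eqF s0)/= ww -!EFinM.
have w0 : 0 < (s ^+ 2) `^ (- A) by rewrite powR_gt0// exprn_gt0.
have d0s : 0 <= d <= s by rewrite d0.
have up := hC s d s1 d0s dt.
apply/andP; split; last first.
  apply: (le_trans up); rewrite lee_fin -[C * K * _]mulrA ler_pM2l//.
  have -> : expR (- (c2 * d)) = expR (- (c2 / 2 * d)) * expR (- (c2 / 2 * d)).
    by rewrite -expRD; congr expR; field.
  apply: (@le_trans _ _ ((s ^+ 2) `^ (- A) * (expR (- (c2 / 2 * d)) * expR (- (c2 / 2 * d))) *
     (K * (b * expR (c2 / 2 * d))))).
    by rewrite ler_pM2l// !mulr_gt0 ?expR_gt0.
  rewrite expRN; have E0 : expR (c2 / 2 * d) != 0 by rewrite gt_eqF// expR_gt0.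
  move: (expR _) E0 (_ `^ _) => E E0 w.
  by rewrite [leLHS](_ : _ = K * (w * b / E)) ?lexx//; field.
have [d'|d'] := ltP 0 d.
  have hds : 0 < d <= s by rewrite d'.
  apply: le_trans (hC' s d s1 hds); rewrite lee_fin.
  rewrite -!mulrA ler_pM2l//.
  have e1 : expR (- c1) <= 1 by rewrite -[leRHS]expR0 ler_expR oppr_le0 ltW.
  rewrite [leLHS](_ : _ = expR (- c1) * ((s ^+ 2) `^ (- A) * (expR (- (c1 * d)) *
    (K^-1 * b)))); last by ring.
  rewrite -[leRHS]mul1r; apply: ler_pM => //; rewrite ?expR_ge0//.
    by rewrite !mulr_ge0 ?expR_ge0 ?(ltW w0) ?(ltW b0) ?invr_ge0 ?(ltW K0).
  rewrite ler_pM2l// ler_pM2l ?expR_gt0//.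
  by rewrite ler_pdivrMl.
have t0 : 0 < tau by move: dt; rewrite [0 < d]ltNge d'.
have ed : d = 0 by apply/le_anti; rewrite d0 d'.
move: b1; rewrite /powsize t0 powR1 mulr1 => b1.
have h1 : 0 <= s <= s by rewrite (ltW s0)/=.
have h2 : (0 : R) <= d <= (1 : R) by rewrite ed lexx ler01.
apply: le_trans (potential_antitone tau A c s d s 1 A0 c0 h1 h2).
have hds : (0 : R) < (1 : R) <= s by rewrite ltr01 s1.
apply: le_trans (hC' s 1 s1 hds); rewrite lee_fin /powsize t0 powR1 ed mulr0 oppr0 expR0 !mulr1.
rewrite [leLHS](_ : _ = C' * ((s ^+ 2) `^ (- A) * expR (- c1)) * (K^-1 * b)); last by ring.
by rewrite ler_piMr ?mulr_ge0 ?expR_ge0 ?(ltW w0) ?(ltW C'0)// ler_pdivrMl// mulr1.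
Qed.

End LargeScale.

(** * Assembly *)

Section Assembly.
Context {R : realType}.

(** Chains the bounds on the kernel with those on the potential integral. The
    integrals J and J' differ by the constant in the Gaussian, the targets Yl and
    Yu by the constant in the exponential decay. *)
Lemma comparable_combine (c C c' C' : R) (X J J' Yl Yu : \bar R) :
  0 < c -> 0 < C -> 0 < c' -> 0 < C' -> (0 <= Yl)%E -> (0 <= Yu)%E ->
  (c%:E * J <= X <= C%:E * J')%E -> (c'%:E * Yl <= J)%E -> (J' <= C'%:E * Yu)%E ->
  ((Num.max (c * c')^-1 (C * C'))^-1%:E * Yl <= X <=
   (Num.max (c * c')^-1 (C * C'))%:E * Yu)%E.
Proof.
move=> c0 C0 c'0 C'0 l0 u0 /andP[h1 h2] hl hu.
set K := Num.max _ _.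
have K0 : 0 < K by rewrite lt_max invr_gt0 mulr_gt0.
apply/andP; split.
  apply: le_trans h1; apply: (@le_trans _ _ (c%:E * (c'%:E * Yl))%E); last first.
    by apply: lee_wpmul2l; rewrite ?lee_fin ?(ltW c0).
  rewrite muleA -EFinM; apply: lee_wpmul2r => //; rewrite lee_fin.
  by rewrite invf_ple ?posrE ?mulr_gt0// le_max lexx.
apply: (le_trans h2); apply: (@le_trans _ _ (C%:E * (C'%:E * Yu))%E).
  by apply: lee_wpmul2l; rewrite ?lee_fin ?(ltW C0).
rewrite muleA -EFinM; apply: lee_wpmul2r => //; rewrite lee_fin.
by rewrite le_max lexx orbT.
Qed.

Lemma combine_gt0 (c C c' C' : R) : 0 < c -> 0 < C -> 0 < c' -> 0 < C' ->
  0 < Num.max (c * c')^-1 (C * C').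
Proof. by move=> *; rewrite lt_max invr_gt0 mulr_gt0. Qed.

Lemma ge0_of_le_mule (C : R) (J Y : \bar R) : 0 < C -> (0 <= J)%E ->
  (J <= C%:E * Y)%E -> (0 <= Y)%E.
Proof. by move=> C0 J0 /(le_trans J0); rewrite pmule_rge0// lte_fin. Qed.

Lemma small_scale_transfer (P : R -> R -> Prop) (X : R -> R -> \bar R)
    (D : R -> R -> R) (c C tau A : R) : 0 < A -> 0 < c -> 0 < C ->
  (forall x y, P x y ->
     0 <= D x y <= `|x| + `|y| /\
     (c%:E * potential tau A 4^-1 (`|x| + `|y|)%R (D x y) <= X x y <=
      C%:E * potential tau A 8^-1 (`|x| + `|y|)%R (D x y))%E) ->
  comparable_on (fun x y => P x y /\ `|x| + `|y| <= 1) X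
    (fun x y => small_size tau A (`|x| + `|y|) (D x y)).
Proof.
move=> A0 c0 C0 h.
have q4 : 0 < 4^-1 :> R by rewrite invr_gt0.
have q8 : 0 < 8^-1 :> R by rewrite invr_gt0.
have [C1 [c1 [C10 c10 h1]]] := potential_small_comparable tau A 4^-1 A0 q4.
have [C2 [c2 [C20 c20 h2]]] := potential_small_comparable tau A 8^-1 A0 q8.
exists (Num.max (c * c1)^-1 (C * C2)); first exact: combine_gt0.
move=> x y [/h[Dxy hX] s1].
have s01 : 0 <= `|x| + `|y| <= 1 by rewrite addr_ge0.
have /andP[l1 _] := h1 _ _ s01 Dxy.
have /andP[_ u2] := h2 _ _ s01 Dxy.
have Y0 := ge0_of_le_mule _ _ _ C20 (potential_ge0 _ _ _ _ _) u2.
exact: comparable_combine hX l1 u2.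
Qed.

Lemma large_scale_transfer (P : R -> R -> Prop) (X : R -> R -> \bar R)
    (D : R -> R -> R) (c C tau A : R) : 0 < A -> 0 < c -> 0 < C ->
  (forall x y, P x y ->
     0 <= D x y <= `|x| + `|y| /\
     (c%:E * potential tau A 4^-1 (`|x| + `|y|)%R (D x y) <= X x y <=
      C%:E * potential tau A 8^-1 (`|x| + `|y|)%R (D x y))%E) ->
  exp_comparable_on (fun x y => P x y /\ 1 < `|x| + `|y|) X
    (fun x y => large_size tau A (`|x| + `|y|) (D x y)) D.
Proof.
move=> A0 c0 C0 h.
have q4 : 0 < 4^-1 :> R by rewrite invr_gt0.
have q8 : 0 < 8^-1 :> R by rewrite invr_gt0.
have [C1 [k1 [a1 [b1 [C10 k10 a10 b10 h1]]]]] :=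
  potential_large_comparable tau A 4^-1 A0 q4.
have [C2 [k2 [a2 [b2 [C20 k20 a20 b20 h2]]]]] :=
  potential_large_comparable tau A 8^-1 A0 q8.
exists (Num.max (c * k1)^-1 (C * C2)), a1, b2.
split => //; first exact: combine_gt0.
move=> x y [/h[Dxy hX] s1].
have /andP[l1 u1] := h1 _ _ (ltW s1) Dxy.
have /andP[_ u2] := h2 _ _ (ltW s1) Dxy.
have Yu := ge0_of_le_mule _ _ _ C20 (potential_ge0 _ _ _ _ _) u2.
have Y0 : (0 <= large_size tau A (`|x| + `|y|)%R (D x y))%E.
  by move: Yu; rewrite muleC pmule_rge0// lte_fin expR_gt0.
have Yl : (0 <= large_size tau A (`|x| + `|y|)%R (D x y) * (expR (- (a1 * D x y)))%:E)%E.
  by rewrite mule_ge0// lee_fin expR_ge0.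
exact: comparable_combine hX l1 u2.
Qed.

Lemma comparable_on_eq (P : R -> R -> Prop) (X Y Y' : R -> R -> \bar R) :
  (forall x y, P x y -> Y x y = Y' x y) -> comparable_on P X Y -> comparable_on P X Y'.
Proof. by move=> e [C C0 h]; exists C => // x y p; rewrite -e//; exact: h. Qed.

Lemma exp_comparable_on_eq (P : R -> R -> Prop) (X Y Y' : R -> R -> \bar R)
    (Z : R -> R -> R) :
  (forall x y, P x y -> Y x y = Y' x y) ->
  exp_comparable_on P X Y Z -> exp_comparable_on P X Y' Z.
Proof.
move=> e [C [c1 [c2 [C0 c10 c20 h]]]]; exists C, c1, c2; split => // x y p.
by rewrite -e//; exact: h.
Qed.

End Assembly.

(* In (Ai), for sigma > 1/2, the two powers of |x| + |y| are written as one
   power, which fixes the limiting value of their product at x = y = 0. *)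
Theorem theorem2p18 (R : realType) (alpha sigma : R)
    (halpha : - 2^-1 < alpha) (hsigma : 0 < sigma) :
  [/\ (* (Ai) *)
      comparable_on
        (fun x y : R => 0 <= x * y /\ `|x| + `|y| <= 1)
        (bessel_potential_kernel alpha sigma)
        (fun x y : R =>
           chi R (alpha + 1 < sigma)%R
           + chi R (sigma == alpha + 1)%R * lne (equot 1%R (`|x| + `|y|)%R)
           + (if (sigma < 2^-1)%R then
                epow (`|x| + `|y|)%R (- 2 * alpha - 1)%R
                * epow `|x - y|%R (2 * sigma - 1)%R
              else if sigma == 2^-1%R then
                epow (`|x| + `|y|)%R (- 2 * alpha - 1)%R
                * lne (equot (2 * (`|x| + `|y|))%R `|x - y|%R)
              else
                epow (`|x| + `|y|)%R ((- 2 * alpha - 1) + (2 * sigma - 1))%R))%E,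
      (* (Aii) *)
      exp_comparable_on
        (fun x y : R => 0 <= x * y /\ 1 < `|x| + `|y|)
        (bessel_potential_kernel alpha sigma)
        (fun x y : R =>
           epow (`|x| + `|y|)%R (- 2 * alpha - 1)%R
           * (if (sigma < 2^-1)%R then epow `|x - y|%R (2 * sigma - 1)%R
              else if sigma == 2^-1%R then
                1 + maxe (lne (equot 1%R `|x - y|%R)) 0
              else 1))%E
        (fun x y : R => `|x - y|),
      (* (Bi) *)
      comparable_on
        (fun x y : R => x * y < 0 /\ `|x| + `|y| <= 1)
        (bessel_potential_kernel alpha sigma)
        (fun x y : R =>
           chi R (alpha + 1 < sigma)%R
           + chi R (sigma == alpha + 1)%R * lne (equot 1%R (`|x| + `|y|)%R)
           + epow (`|x| + `|y|)%R (2 * sigma - 2 * alpha - 2)%R)%E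
    & (* (Bii) *)
      exp_comparable_on
        (fun x y : R => x * y < 0 /\ 1 < `|x| + `|y|)
        (bessel_potential_kernel alpha sigma)
        (fun x y : R =>
           epow (`|x| + `|y|)%R (- 2 * alpha - 1)%R
           * epow (`|x| + `|y|)%R (- 2)%R)%E
        (fun x y : R => `|x + y|)].
Proof.
have A0 : 0 < alpha + 2^-1 by rewrite -ltrBlDr sub0r.
have A1 : 0 < alpha + 2^-1 + 1 by rewrite addr_gt0.
have [c [C [c0 C0 hs]]] := bessel_potential_same_sign alpha sigma halpha hsigma.
have [c' [C' [c'0 C'0 ho]]] := bessel_potential_opposite_sign alpha sigma halpha hsigma.
have same x y : 0 <= x * y -> 0 <= `|x - y| <= `|x| + `|y| /\ _ :=
  fun xy => conj (introT andP (conj (normr_ge0 _) (ler_normB x y))) (hs x y xy).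
have opp x y : x * y < 0 -> 0 <= `|x + y| <= `|x| + `|y| /\ _ :=
  fun xy => conj (introT andP (conj (normr_ge0 _) (ler_normD x y))) (ho x y xy).
have eA : - 2 * alpha - 1 = - 2 * (alpha + 2^-1) by field.
have t0 : (sigma - 2^-1 < 0) = (sigma < 2^-1) by rewrite subr_lt0.
have tz : (sigma - 2^-1 == 0) = (sigma == 2^-1) by rewrite subr_eq0.
have u0 : 0 < sigma + 2^-1 by rewrite addr_gt0// invr_gt0.
have us : sigma + 2^-1 < 0 = false by rewrite ltNge (ltW u0).
split.
- apply: comparable_on_eq (small_scale_transfer _ _ _ _ _ _ _ A0 c0 C0 same) => x y _.
  rewrite /small_size t0 tz eA.
  have -> : (alpha + 2^-1 < sigma - 2^-1) = (alpha + 1 < sigma).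
    by rewrite ltrBrDr; congr (_ < _); field.
  have -> : (sigma - 2^-1 == alpha + 2^-1) = (sigma == alpha + 1).
    by rewrite subr_eq; congr (_ == _); field.
  have -> : 2 * (sigma - 2^-1) = 2 * sigma - 1 by field.
  have -> : 2 * (sigma - 2^-1 - (alpha + 2^-1)) =
    - 2 * (alpha + 2^-1) + (2 * sigma - 1) by field.
  by [].
- apply: exp_comparable_on_eq (large_scale_transfer _ _ _ _ _ _ _ A0 c0 C0 same) => x y _.
  rewrite /large_size /large_factor t0 tz eA.
  by have -> : 2 * (sigma - 2^-1) = 2 * sigma - 1 by field.
- apply: comparable_on_eq (small_scale_transfer _ _ _ _ _ _ _ A1 c'0 C'0 opp) => x y _.
  rewrite /small_size us (gt_eqF u0).
  have -> : (alpha + 2^-1 + 1 < sigma + 2^-1) = (alpha + 1 < sigma).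
    by rewrite addrAC ltrD2r.
  have -> : (sigma + 2^-1 == alpha + 2^-1 + 1) = (sigma == alpha + 1).
    by rewrite [alpha + _ + _]addrAC (inj_eq (addIr _)).
  by have -> : 2 * (sigma + 2^-1 - (alpha + 2^-1 + 1)) = 2 * sigma - 2 * alpha - 2
    by field.
- apply: exp_comparable_on_eq (large_scale_transfer _ _ _ _ _ _ _ A1 c'0 C'0 opp) => x y [_ s1].
  rewrite /large_size /large_factor us (gt_eqF u0) mule1.
  have s0 : 0 < `|x| + `|y| by exact: lt_trans s1.
  rewrite /epow (gt_eqF s0)/= -EFinM -powRD ?(gt_eqF s0) ?implybT//.
  by congr (_ `^ _)%:E; field.
Qed.
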